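(* If $G$ is a $2$-connected outerplanar graph with $\Delta(G)=\Delta\geq 4$ and girth $g(G)\geq 6$, then $\chi_{vi,1}(G)=\Delta+2$.
   Context: All graphs are finite, simple and undirected. An incidence of $G$ is a pair $(v,e)$ with $v\in V(G)$, $e\in E(G)$, $v\in e$; $I(G)$ is the set of incidences. Let $G^{1/3}$ be obtained from $G$ by replacing each edge $e=\{u,v\}$ by the path $u,(u,e),(v,e),v$. A $vi$-simultaneous proper $k$-coloring of $G$ is a map $c:V(G)\cup I(G)\to\{1,\dots,k\}$ such that any two distinct elements at distance at most $3$ in $G^{1/3}$ receive distinct colors. For a vertex $v$, $I_2(v)=\{(u,\{u,v\}) : u\in N_G(v)\}$. Such a coloring is a $(k,s)$-coloring if for every vertex $v$ at most $s$ distinct colors appear on $I_2(v)$; $\chi_{vi,s}(G)$ is the least such $k$. The girth is the length of a shortest cycle. A graph is outerplanar if it has a planar drawing with all vertices on the outer face. *)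

(* Defs.v *)
From HB Require Import structures.
From mathcomp Require Import all_boot all_order all_algebra.
From mathcomp Require Import all_classical all_reals topology normedtype.

Set Implicit Arguments.
Unset Strict Implicit.
Unset Printing Implicit Defensive.

Import Order.TTheory GRing.Theory Num.Theory.
Import numFieldNormedType.Exports.

Record sgraph := SGraph {
  vertex :> finType;
  adj : rel vertex;
  adj_sym : symmetric adj;
  adj_irr : irreflexive adj }.

Section Graph.
Variable G : sgraph.

Definition neighbours (v : G) : {set G} := [set u | adj v u].

Definition max_degree : nat := \max_(v : G) #|neighbours v|.

Definition edges : {set {set G}} :=
  [set e : {set G} | [exists u, exists v, adj u v && (e == [set u; v])]].

(* A cycle is listed by its vertices in cyclic order; the bound on the size
   rules out the closed walks [:: u; v] along a single edge. *)
Definition is_cycle (p : seq G) : bool := (2 < size p) && ucycleb (@adj G) p.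

(* The girth of a graph without cycles is infinite. *)
Definition girth_ge (g : nat) : Prop := forall p, is_cycle p -> g <= size p.

Definition connected_without (S : {set G}) : Prop :=
  forall x y, x \notin S -> y \notin S ->
    connect [rel u v | [&& u \notin S, v \notin S & adj u v]] x y.

Definition k_connected (k : nat) : Prop :=
  k < #|G| /\ forall S : {set G}, #|S| < k -> connected_without S.

Definition dist_le (n : nat) (x y : G) : Prop :=
  exists p, [/\ path (@adj G) x p, last x p = y & size p <= n].

End Graph.

Section Incidences.
Variable G : sgraph.

Definition incidence : Type :=
  {p : G * {set G} | (p.2 \in edges G) && (p.1 \in p.2)}.

Definition inc_vertex (i : incidence) : G := (val i).1.
Definition inc_edge (i : incidence) : {set G} := (val i).2.

Definition third_adj (x y : G + incidence) : bool :=
  match x, y with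
  | inl _, inl _ => false
  | inl u, inr i => u == inc_vertex i
  | inr i, inl u => u == inc_vertex i
  | inr i, inr j => (inc_edge i == inc_edge j) && (inc_vertex i != inc_vertex j)
  end.

Lemma third_adj_sym : symmetric third_adj.
Proof. by move=> [u|i] [v|j] //=; rewrite eq_sym [X in _ && ~~ X]eq_sym. Qed.

Lemma third_adj_irr : irreflexive third_adj.
Proof. by move=> [u|i] //=; rewrite !eqxx. Qed.

(* The 1/3-power of G: the edge uv becomes the path u, (u,uv), (v,uv), v. *)
Definition third_power : sgraph := SGraph third_adj_sym third_adj_irr.

Definition I2 (v : G) : {set incidence} :=
  [set i | (inc_vertex i \in neighbours v) &&
           (inc_edge i == [set inc_vertex i; v])].

Definition vi_proper (k : nat) (c : G + incidence -> 'I_k) : Prop :=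
  forall x y : third_power, x != y -> dist_le 3 x y -> c x != c y.

Definition vi_coloring (k s : nat) (c : G + incidence -> 'I_k) : Prop :=
  vi_proper c /\ forall v : G, #|[set c (inr i) | i in I2 v]| <= s.

Definition vi_colorable (k s : nat) : Prop :=
  exists c : G + incidence -> 'I_k, vi_coloring s c.

(* "chi_{vi,s}(G) = k" *)
Definition chi_vi_eq (s k : nat) : Prop :=
  vi_colorable k s /\ forall k', vi_colorable k' s -> k <= k'.

End Incidences.

Section Drawing.
Local Open Scope classical_set_scope.
Local Open Scope ring_scope.
Variables (R : realType) (G : sgraph).

(* Vertices are points of the plane and edges are arcs, parametrised by [0, 1];
   the values of [edge_arc] outside [edges G] and outside [0, 1] are junk. *)
Record plane_drawing := PlaneDrawing {
  pt : G -> R * R;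
  edge_arc : {set G} -> R -> R * R;
  pt_inj : injective pt;
  arc_continuous : forall e, e \in edges G -> {within `[0, 1], continuous (edge_arc e)};
  arc_inj : forall e, e \in edges G -> {in `[0, 1] &, injective (edge_arc e)};
  arc_ends : forall e, e \in edges G ->
    [set edge_arc e 0; edge_arc e 1] = pt @` [set` e];
  arc_vertex : forall e v (t : R), e \in edges G -> t \in `]0, 1[ -> edge_arc e t <> pt v;
  arc_disjoint : forall e e' (t t' : R), e \in edges G -> e' \in edges G -> e <> e' ->
    t \in `]0, 1[ -> t' \in `]0, 1[ -> edge_arc e t <> edge_arc e' t' }.

Definition drawn (d : plane_drawing) : set (R * R) :=
  range (pt d) `|` \bigcup_(e in [set` edges G]) (edge_arc d e @` `[0, 1]).

Definition is_face (d : plane_drawing) (F : set (R * R)) : Prop :=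
  exists2 x, (~` drawn d) x & F = connected_component (~` drawn d) x.

Definition is_outer_face (d : plane_drawing) (F : set (R * R)) : Prop :=
  is_face d F /\ ~ bounded_set F.

(* Faces are disjoint from the drawing, so a vertex lies on a face when it lies
   in the closure of that face. *)
Definition outerplanar : Prop :=
  exists (d : plane_drawing) (F : set (R * R)),
    is_outer_face d F /\ forall v, closure F (pt d v).

End Drawing.

(* Main.v *)
Require Import Defs.
From mathcomp Require Import all_boot all_order all_algebra.
From mathcomp Require Import all_classical all_reals topology normedtype.
From mathcomp Require Import zify ring lra.

Set Implicit Arguments.
Unset Strict Implicit.
Unset Printing Implicit Defensive.

Import Order.TTheory GRing.Theory Num.Theory.
Import numFieldNormedType.Exports.

(** The graph [G] contains no theta graph whose three branches all have inner
    vertices: joining one inner vertex of each branch to a point of the outer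
    face would draw [K33] in the plane. The latter is impossible by van Kampen's
    parity argument: summed over the pairs of disjoint edges of [K33], the
    number of crossings modulo 2 does not depend on the drawing, and is odd.
    Hence the longest cycle of [G] is spanning and its chords do not cross. In
    every induced subgraph of minimum degree 2, a chord cutting off a minimal
    part bounds a face of length at least 6, all but two of whose vertices have
    degree 2; so every induced subgraph has a vertex of degree at most 1 or a
    path of four vertices of degree 2, and the coloring is built greedily along
    these. Conversely, a vertex of degree [Delta], its incidences and one
    incidence across are pairwise at distance at most 3. *)

(** * Crossing parity *)

Section Crossing.
Variables (T : eqType) (al be : rel T).

(* [al] and [be] compare abscissas and ordinates. A step from [p] to [q] is
   drawn as a horizontal segment followed by a vertical one, and [step_cross]
   is the parity of the crossings of two such steps. *)
Definition step_cross (p q r s : T) : bool :=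
  ((al p s (+) al q s) && (be p r (+) be p s)) (+)
  ((al q r (+) al q s) && (be p r (+) be q r)).

(* Parity of the crossings of the path with the vertical ray below [v]. *)
Fixpoint ray_below (x : T) (e : seq T) (v : T) : bool :=
  if e is y :: e' then (be x v && (al x v (+) al y v)) (+) ray_below y e' v
  else false.

Fixpoint ray_above (x : T) (e : seq T) (v : T) : bool :=
  if e is y :: e' then (be v x && (al v x (+) al v y)) (+) ray_above y e' v
  else false.

Fixpoint uncrossed_step (p q r : T) (f : seq T) : bool :=
  if f is s :: f' then ~~ step_cross p q r s && uncrossed_step p q s f'
  else true.

Fixpoint uncrossed (p : T) (e : seq T) (r : T) (f : seq T) : bool :=
  if e is q :: e' then uncrossed_step p q r f && uncrossed q e' r f else true.

(** Expanding [step_cross p q r s] over the field with two elements gives exactly four ray parities,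
    at [r], [s], [p] and [q], whatever the relations. Along [f], the terms at inner points cancel in
    pairs. *)
Lemma uncrossed_step_rays p q r f : uncrossed_step p q r f ->
  (be p r && (al p r (+) al q r)) (+)
  (be p (last r f) && (al p (last r f) (+) al q (last r f))) (+)
  ray_above r f p (+) ray_above r f q = false.
Proof.
elim: f r => [|s f IH] r /=; first by rewrite !addbF addbb.
case/andP=> /negbTE; rewrite /step_cross => Hs /IH <- {IH}.
move: (ray_above s f p) (ray_above s f q) Hs => u v.
case: (al p r) (al q r) (al p s) (al q s) (be p r) (be q r) (be p s) (be q s) (be p (last s f) && _) u v => [] [] [] [] [] [] [] [] [] [] [] //=.
Qed.

Lemma uncrossed_rays p e r f : uncrossed p e r f ->
  ray_below p e r (+) ray_below p e (last r f) (+)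
  ray_above r f p (+) ray_above r f (last p e) = false.
Proof.
elim: e p => [|q e IH] p /=; first by rewrite addbb.
case/andP=> /uncrossed_step_rays H1 /IH H2.
move: H1 H2.
move: (be p r && _) (be p (last r f) && _) (ray_above r f p) (ray_above r f q) (ray_above r f (last q e)) (ray_below q e r) (ray_below q e (last r f)).
by do 7 case.
Qed.

(** The two rays at [v] make up a vertical line, and the parity of the crossings of a path with a
    line depends only on the sides of its ends. *)
Lemma ray_below_above x e v :
  {in x :: e, forall p, al v p = ~~ al p v /\ be v p = ~~ be p v} ->
  ray_below x e v (+) ray_above x e v = al x v (+) al (last x e) v.
Proof.
elim: e x => [|y e IH] x H /=; first by rewrite addbb.
have [ax bx] := H x (mem_head _ _).
have [ay _] : al v y = ~~ al y v /\ be v y = ~~ be y v.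
  by apply: H; rewrite !inE eqxx orbT.
have := IH y; rewrite ax ay bx => {}IH.
have /IH : {in y :: e, forall p, al v p = ~~ al p v /\ be v p = ~~ be p v}.
  by move=> p Hp; apply: H; rewrite inE Hp orbT.
move: (be x v) (al x v) (al y v) (al (last y e) v) => b1 b2 b3 b4.
by case: b1 b2 b3 b4 (ray_below _ _ _) (ray_above _ _ _) => [] [] [] [] [] [].
Qed.

(* The 18 relations given by [uncrossed_rays] add up, for each pair [j != l], to
   [w j (+) w l], where [w] does not depend on the pair: three booleans cannot
   be pairwise distinct. *)
Lemma K33_crossing (a y : nat -> T) (e : nat -> nat -> seq T) :
  (forall i j, i < 3 -> j < 3 -> last (a i) (e i j) = y j) ->
  (forall i k j l, i < k < 3 -> j < 3 -> l < 3 -> j != l ->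
     uncrossed (a i) (e i j) (a k) (e k l)) ->
  (forall j l, j < 3 -> l < 3 -> j != l ->
     {in a 1 :: e 1 j, forall p, al (y l) p = ~~ al p (y l) /\
                                 be (y l) p = ~~ be p (y l)}) -> False.
Proof.
move=> Hl Hu Ha.
pose rb i j v := ray_below (a i) (e i j) v.
pose ra i j v := ray_above (a i) (e i j) v.
have E i k j l : i < k < 3 -> j < 3 -> l < 3 -> j != l ->
    rb i j (a k) (+) rb i j (y l) (+) ra k l (a i) (+) ra k l (y j) = false.
  move=> ik j3 l3 jl; have /andP[lt_ik k3] := ik.
  have := uncrossed_rays (Hu i k j l ik j3 l3 jl).
  by rewrite !Hl // (ltn_trans lt_ik).
have M j l : j < 3 -> l < 3 -> j != l ->
    rb 1 j (y l) (+) ra 1 j (y l) = al (a 1) (y l) (+) al (y j) (y l).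
  by move=> j3 l3 jl; rewrite /rb /ra (ray_below_above (Ha j l j3 l3 jl)) Hl.
have A j l : j < 3 -> l < 3 -> j != l -> al (y l) (y j) = ~~ al (y j) (y l).
  move=> j3 l3 jl; have [] // := Ha j l j3 l3 jl (y j).
  by rewrite -(Hl 1 j) // mem_last.
pose P j := rb 0 j (a 1) (+) rb 0 j (a 2) (+) rb 1 j (a 2).
pose Q j := ra 1 j (a 0) (+) ra 2 j (a 0) (+) ra 2 j (a 1).
(* In the sum of the three relations for [i < k], the terms [rb 0 j (y l)] and [ra 2 l (y j)] occur
   twice and cancel; only the paths from [a 1] still see the points [y]. *)
have PQ j l : j < 3 -> l < 3 -> j != l ->
    P j (+) Q l (+) rb 1 j (y l) (+) ra 1 l (y j) = false.
  move=> j3 l3 jl; rewrite /P /Q.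
  move: (E 0 1 j l erefl j3 l3 jl) (E 0 2 j l erefl j3 l3 jl) (E 1 2 j l erefl j3 l3 jl).
  case: (rb 0 j (a 1)) (rb 0 j (a 2)) (rb 1 j (a 2)) (rb 0 j (y l)) => [] [] [] [];
  by case: (ra 1 l (a 0)) (ra 2 l (a 0)) (ra 2 l (a 1)) (ra 1 l (y j)) (ra 2 l (y j)) (rb 1 j (y l)) => [] [] [] [] [] [].
pose w j := P j (+) Q j (+) al (a 1) (y j).
(* In the sum of [PQ] for [(j, l)] and for [(l, j)], [M] turns the remaining rays into comparisons.
   The odd contribution is [al (y j) (y l) (+) al (y l) (y j)]. *)
have W j l : j < 3 -> l < 3 -> j != l -> w j (+) w l.
  move=> j3 l3 jl; have lj : l != j by rewrite eq_sym.
  move: (PQ j l j3 l3 jl) (PQ l j l3 j3 lj) (M j l j3 l3 jl) (M l j l3 j3 lj).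
  rewrite (A j l) // /w.
  case: (P j) (P l) (Q j) (Q l) (rb 1 j (y l)) (rb 1 l (y j)) => [] [] [] [] [] [];
  by case: (ra 1 j (y l)) (ra 1 l (y j)) (al _ (y l)) (al _ (y j)) (al (y j) _) => [] [] [] [] [].
have := W 0 1 erefl erefl erefl; have := W 0 2 erefl erefl erefl.
have := W 1 2 erefl erefl erefl.
by case: (w 0) (w 1) (w 2) => [] [] [].
Qed.
End Crossing.

(** * Nonplanarity of K33 *)

Section Connectedness.
Local Open Scope classical_set_scope.

(** The class of [x] is nonempty and both open and closed relative to [A]. Reflexivity comes from
    the local hypothesis. *)
Lemma connected_locally_related (T : topologicalType) (A : set T)
    (r : T -> T -> Prop) :
  connected A -> (forall x y, r x y -> r y x) ->
  (forall x y z, r x y -> r y z -> r x z) ->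
  (forall x, A x -> \forall y \near x, A y -> r x y) ->
  forall x y, A x -> A y -> r x y.
Proof.
move=> cA rC rT rL x y Ax Ay.
have rx : r x x by have /nbhs_singleton := rL x Ax; apply.
suff /seteqP[_ /(_ y Ay)[]] // : [set z | A z /\ r x z] = A by [].
apply: cA; first by exists x.
(* Points outside [A] satisfy the implication vacuously, so a neighbourhood relative to [A] becomes
   one in the whole space. *)
- exists (interior [set z | A z -> r x z]); first exact: open_interior.
  apply/seteqP; split=> z /= [Az Hz]; split=> //.
    near=> t => At; apply: rT Hz _.
    by move: At; near: t; exact: rL.
  by move/nbhs_singleton: Hz; exact.
- exists (~` interior [set z | A z -> ~ r x z]).
    exact/open_closedC/open_interior.
  apply/seteqP; split=> z /= [Az Hz]; split=> //.
    by move/nbhs_singleton => /(_ Az).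
  apply: contrapT => nr; apply: Hz.
  near=> t => At rxt; apply: nr; apply: rT rxt _; apply: rC.
  by move: At; near: t; exact: rL.
Unshelve. all: by end_near. Qed.
End Connectedness.

Section Plane.
Variable R : realType.
Local Open Scope classical_set_scope.
Local Open Scope ring_scope.
Implicit Types (p q r : R * R) (K L : set (R * R)).

Definition near_pt (e : R) : rel (R * R) :=
  fun p q => (`|p.1 - q.1| < e) && (`|p.2 - q.2| < e).

Lemma near_ptP e p q : reflect (ball p e q) (near_pt e p q).
Proof. exact: andP. Qed.

(** Each point of [K] has a ball clear of the closed set [L], and compactness makes the radius
    uniform. The filter form lets finitely many pairs be treated at once. *)
Lemma compact_separated K L : compact K -> compact L -> K `&` L = set0 ->
  \forall e \near 0^'+, forall p q, K p -> L q -> ~~ near_pt e p q.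
Proof.
move=> cK cL KL0.
have cL' : closed L by apply: compact_closed => //; exact: norm_hausdorff.
move/compact_near_coveringP: (cK) => ncK.
suff : \forall e \near 0^'+, K `<=` [set p | forall q, L q -> ~~ near_pt e p q].
  by apply: filterS => e H p q Kp; exact: H.
apply: ncK => p Kp.
have nLp : ~ L p by move=> Lp; have : (K `&` L) p by []; rewrite KL0.
have : nbhs p (~` L) by apply: open_nbhs_nbhs; split => //; exact: closed_openC.
move=> /nbhs_ballP[e /= e0 He].
have e2 : 0 < e / 2 by rewrite divr_gt0.
exists (ball p (e / 2), [set x | 0 < x < e / 2]) => /=.
  split; first exact: nbhsx_ballx.
  by near=> x => /=; apply/andP; split; near: x; [exact: nbhs_right_gt | exact: nbhs_right_lt].
move=> [q d] /= [Hq /andP[d0 d2]] r Lr; apply/negP => /near_ptP Hr.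
apply: (He r) => //.
rewrite (splitr e); apply: ball_triangle Hq _.
by apply: le_ball Hr; exact: ltW.
Unshelve. all: by end_near. Qed.

(** Fine chains discretize connected sets, so that crossings can be counted combinatorially. Being
    linked by a chain is an equivalence that holds between nearby points. *)
Lemma connected_chain K e p q : connected K -> 0 < e -> K p -> K q ->
  exists s, [/\ path (near_pt e) p s, last p s = q & {in p :: s, forall r, K r}].
Proof.
move=> cK e0; move: p q.
apply: connected_locally_related => //=.
- move=> p q [s [ps <- Ks]]; exists (rev (belast p s)); split.
  + rewrite rev_path; apply: sub_path ps => r t.
    by rewrite /near_pt distrC (distrC r.2).
  + by case: s {ps Ks} => //= r s; rewrite rev_cons last_rcons.
  + by move=> r; rewrite -(rev_rcons (belast p s)) -lastI mem_rev; exact: Ks.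
- move=> p q r [s [ps qs Ks]] [t [pt rt Kt]]; exists (s ++ t); split.
  + by rewrite cat_path ps qs.
  + by rewrite last_cat qs.
  + move=> z; rewrite -cat_cons mem_cat => /orP[/Ks//|zt].
    by apply: Kt; rewrite inE zt orbT.
- move=> p Kp; near=> q => Kq; exists [:: q] => /=; split => //.
    by rewrite andbT; apply/near_ptP; near: q; exact: nbhsx_ballx.
  by move=> r; rewrite !inE => /orP[/eqP->|/eqP->].
Unshelve. all: by end_near. Qed.

(* Labels break ties between equal coordinates, which puts the labelled points
   in general position without moving them. *)
Definition lab_lt (f : R * R -> R) : rel ((R * R) * nat) :=
  fun x y => (f x.1 < f y.1) || (f x.1 == f y.1) && (x.2 < y.2)%N.

Lemma lab_ltN f (p q : (R * R) * nat) : p.2 != q.2 -> lab_lt f q p = ~~ lab_lt f p q.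
Proof.
rewrite /lab_lt neq_ltn; case: (ltgtP (f p.1) (f q.1)) => //= _.
by case: ltngtP.
Qed.

(** A gap of [3 * e] outweighs two deviations below [e], so all four comparisons are decided
    strictly by [f] and the labels do not intervene. *)
Lemma lab_lt_far f e (p q r s : (R * R) * nat) :
  `|f p.1 - f q.1| < e -> `|f r.1 - f s.1| < e ->
  3 * e <= `|f p.1 - f r.1| ->
  [/\ lab_lt f q r = lab_lt f p r, lab_lt f p s = lab_lt f p r
    & lab_lt f q s = lab_lt f p r].
Proof.
have E x y : f x.1 != f y.1 -> lab_lt f x y = (f x.1 < f y.1).
  by rewrite /lab_lt; case: ltgtP.
move: (f p.1) (f q.1) (f r.1) (f s.1) (E p r) (E q r) (E p s) (E q s) => {E} x y z t E1 E2 E3 E4.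
rewrite !ltr_norml => /andP[H1 H2] /andP[H3 H4].
by rewrite ler_normr => /orP[H|H]; (rewrite E1 ?E2 ?E3 ?E4; first split);
   first [apply/idP/idP; lra | rewrite neq_lt; lra ].
Qed.

Definition lab_near e : rel ((R * R) * nat) := fun x y => near_pt e x.1 y.1.

(** Separation in abscissa makes both [al] factors of [step_cross] vanish, separation in ordinate
    both [be] factors. *)
Lemma step_uncrossed e (p q r s : (R * R) * nat) :
  lab_near e p q -> lab_near e r s -> ~~ near_pt (3 * e) p.1 r.1 ->
  ~~ step_cross (lab_lt fst) (lab_lt snd) p q r s.
Proof.
move=> /andP[p1 p2] /andP[r1 r2]; rewrite negb_and -!leNgt /step_cross.
case/orP => H.
  by have [-> -> ->] := lab_lt_far p1 r1 H; rewrite !addbb.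
by have [-> -> _] := lab_lt_far p2 r2 H; rewrite !addbb !andbF.
Qed.

Lemma chains_uncrossed e (p r : (R * R) * nat) E F :
  path (lab_near e) p E -> path (lab_near e) r F ->
  {in p :: E & r :: F, forall x y, ~~ near_pt (3 * e) x.1 y.1} ->
  uncrossed (lab_lt fst) (lab_lt snd) p E r F.
Proof.
elim: E p => [//|q E IH] p /= /andP[pq qE] rF H; rewrite IH //; last first.
  by move=> x y xE; apply: H; rewrite inE xE orbT.
rewrite andbT; have : {in r :: F, forall y, ~~ near_pt (3 * e) p.1 y.1}.
  by move=> y; apply: H; rewrite mem_head.
elim: F r rF {H IH} => [//|s F IH] r /= /andP[rs sF] H.
rewrite IH // ?andbT; last by move=> y yF; apply: H; rewrite inE yF orbT.
by apply: step_uncrossed pq rs _; apply: H; rewrite mem_head.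
Qed.

(** Compact connected sets serve as edges, since fine chains replace arcs. As in van Kampen's
    argument, edges with a common end may meet arbitrarily. *)
Lemma K33_nonplanar (a y : nat -> R * R) (K : nat -> nat -> set (R * R)) :
  (forall i j, (i < 3)%N -> (j < 3)%N ->
     [/\ compact (K i j), connected (K i j), K i j (a i) & K i j (y j)]) ->
  (forall i k j l, (i < k < 3)%N -> (j < 3)%N -> (l < 3)%N -> j != l ->
     K i j `&` K k l = set0) -> False.
Proof.
move=> HK Hd.
have : \forall e \near 0^'+, forall (i k j l : 'I_3), (i < k)%N -> j != l :> nat ->
    forall p q, K i j p -> K k l q -> ~~ near_pt e p q.
  apply: filter_forall => i; apply: filter_forall => k.
  apply: filter_forall => j; apply: filter_forall => l.
  case: (boolP (i < k)%N) => ik; last by near=> e.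
  case: (boolP (j != l :> nat)) => jl; last by near=> e.
  have [c1 _ _ _] := HK i j (ltn_ord i) (ltn_ord j).
  have [c2 _ _ _] := HK k l (ltn_ord k) (ltn_ord l).
  have /(compact_separated c1 c2) : K i j `&` K k l = set0 by apply: Hd; rewrite ?ik ?ltn_ord.
  by apply: filterS => e H _ _.
move=> He0; have [e3 [/= e30 He]] := filter_ex (filterI (nbhs_right_gt 0) He0).
(* The mesh [e3 / 3] matches the factor 3 in [chains_uncrossed]. *)
pose e := e3 / 3; have e0 : 0 < e by rewrite divr_gt0.
have Ee : 3 * e = e3 by rewrite /e; lra.
have /choice[c Hc] (ij : nat * nat) : exists s, (ij.1 < 3)%N -> (ij.2 < 3)%N ->
    [/\ path (near_pt e) (a ij.1) s, last (a ij.1) s = y ij.2 &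
        {in a ij.1 :: s, forall r, K ij.1 ij.2 r}].
  case: (ltnP ij.1 3) => i3; last by exists [::].
  case: (ltnP ij.2 3) => j3; last by exists [::].
  have [_ cK Ka Ky] := HK _ _ i3 j3.
  by have [s Hs] := connected_chain cK e0 Ka Ky; exists s.
(* The end [y j] is repeated with label [j], and all other points carry label 3. For [j != l], [y l]
   then differs in label from every point of a chain to [y j], even where the points coincide. *)
pose c' i j := rcons [seq (p, 3%N) | p <- c (i, j)] (y j, j).
have Hc'K i j z : (i < 3)%N -> (j < 3)%N -> z \in (a i, 3%N) :: c' i j -> K i j z.1.
  move=> i3 j3; have [_ _ _ Ky] := HK i j i3 j3; have [_ _ Kc] := Hc (i, j) i3 j3.
  rewrite inE mem_rcons inE => /or3P[/eqP->|/eqP->|/mapP[w wc ->]] //=.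
    by apply: Kc; rewrite mem_head.
  by apply: Kc; rewrite inE wc orbT.
have Hc'p i j : (i < 3)%N -> (j < 3)%N -> path (lab_near e) (a i, 3%N) (c' i j).
  move=> i3 j3; have [pc lc _] := Hc (i, j) i3 j3.
  rewrite rcons_path (last_map (fun p => (p, 3%N))) lc /lab_near /near_pt /= !subrr normr0 e0 andbT.
  by rewrite (@path_map _ _ (fun p => (p, 3%N)) (lab_near e) (a i)) andbT; exact: pc.
apply: (@K33_crossing _ (lab_lt fst) (lab_lt snd) (fun i => (a i, 3%N)) (fun j => (y j, j)) c').
- by move=> i j _ _; rewrite last_rcons.
- move=> i k j l ik j3 l3 jl; have /andP[ik' k3] := ik.
  have i3 := ltn_trans ik' k3.
  apply: (@chains_uncrossed e); [exact: Hc'p | exact: Hc'p |].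
  move=> p q /(Hc'K _ _ _ i3 j3) Kp /(Hc'K _ _ _ k3 l3) Kq; rewrite Ee.
  exact: (He (Ordinal i3) (Ordinal k3) (Ordinal j3) (Ordinal l3)).
- move=> j l j3 l3 jl p; rewrite inE mem_rcons inE => Hp.
  have : p.2 != l.
    case/or3P: Hp => [/eqP->|/eqP->|/mapP[w _ ->]] //=; by rewrite gtn_eqF.
  by move=> pl; split; rewrite lab_ltN.
Unshelve. all: by end_near. Qed.
End Plane.

(** * Drawings of theta graphs *)

Section Segments.
Variable R : realType.
Local Open Scope classical_set_scope.
Local Open Scope ring_scope.
Implicit Types (p q : R * R).

Definition segment p q : set (R * R) :=
  (fun t : R => (p.1 + t * (q.1 - p.1), p.2 + t * (q.2 - p.2))) @` `[0, 1].

Lemma segment_continuous p q : continuous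
  (fun t : R => (p.1 + t * (q.1 - p.1), p.2 + t * (q.2 - p.2))).
Proof.
move=> t.
have aux (x y : R) : x + r * y @[r --> t] --> x + t * y.
  by apply: cvgD; [exact: cvg_cst | apply: cvgMl; exact: cvg_id].
exact: (cvg_pair (aux _ _) (aux _ _)).
Qed.

Lemma compact_segment p q : compact (segment p q).
Proof.
apply: continuous_compact; last exact: segment_compact.
exact/continuous_subspaceT/segment_continuous.
Qed.

Lemma connected_segment p q : connected (segment p q).
Proof.
apply: connected_continuous_connected; first exact: segment_connected.
exact/continuous_subspaceT/segment_continuous.
Qed.

Lemma segmentl p q : segment p q p.
Proof.
exists 0; first by rewrite /= in_itv /= lexx ler01.
by rewrite !mul0r !addr0; case: p.
Qed.

Lemma segmentr p q : segment p q q.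
Proof.
exists 1; first by rewrite /= in_itv /= lexx ler01.
by rewrite !mul1r ![_ + (_ - _)]addrC !subrK; case: q.
Qed.

Lemma segment_ball p q e : ball p e q -> segment p q `<=` ball p e.
Proof.
move=> [/= H1 H2] _ [t /= + <-]; rewrite in_itv /= => /andP[t0 t1].
have aux x y : `|x - y| < e -> `|x - (x + t * (y - x))| < e.
  rewrite opprD addrA subrr sub0r normrN normrM (ger0_norm t0) distrC.
  by apply: le_lt_trans; rewrite ler_piMl.
by split => /=; apply: aux.
Qed.

(** Near a point of [F], short segments stay in [U], and unions of joining sets give transitivity.
    Compactness is what [K33_nonplanar] asks of its edges. *)
Lemma connected_joined (F U : set (R * R)) p q :
  connected F -> open U -> F `<=` U -> F p -> F q ->
  exists L, [/\ compact L, connected L, L `<=` U, L p & L q].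
Proof.
move=> cF oU FU; move: p q; apply: connected_locally_related => //=.
- by move=> p q [L [? ? ? ? ?]]; exists L.
- move=> p q r [L [cL nL LU Lp Lq]] [M [cM nM MU Mq Mr]].
  exists (L `|` M); split.
  + exact: compactU.
  + by apply: connectedU => //; exists q.
  + by rewrite subUset.
  + by left.
  + by right.
- move=> p Fp; have : nbhs p U by apply: open_nbhs_nbhs; split => //; exact: FU.
  move=> /nbhs_ballP[e /= e0 He]; near=> q => Fq; exists (segment p q); split.
  + exact: compact_segment.
  + exact: connected_segment.
  + apply: subset_trans He; apply: segment_ball; near: q; exact: nbhsx_ballx.
  + exact: segmentl.
  + exact: segmentr.
Unshelve. all: by end_near. Qed.
End Segments.

Section Trails.
Variables (R : realType) (G : sgraph) (d : plane_drawing R G).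
Local Open Scope classical_set_scope.
Local Open Scope ring_scope.
Implicit Types (x y z : G) (s t : seq G).

Definition arc (e : {set G}) : set (R * R) := edge_arc d e @` `[0, 1].

Fixpoint trail x s : set (R * R) :=
  if s is y :: s' then arc [set x; y]%SET `|` trail y s' else [set pt d x].

(** The drawing of the subgraph induced by [s], split into vertices and open arcs like the
    disjointness fields of [plane_drawing]. *)
Definition carried (s : seq G) (p : R * R) : Prop :=
  (exists2 z, z \in s & p = pt d z) \/
  (exists e (t : R), [/\ e \in edges G, {subset e <= s}, t \in `]0, 1[ & p = edge_arc d e t]).

Lemma adj_edge x y : adj x y -> [set x; y]%SET \in edges G.
Proof. by move=> xy; rewrite inE; apply/existsP; exists x; apply/existsP; exists y; rewrite xy eqxx. Qed.

Lemma arc_compact e : e \in edges G -> compact (arc e).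
Proof. by move=> eG; apply: continuous_compact; [exact: arc_continuous | exact: segment_compact]. Qed.

Lemma arc_connected e : e \in edges G -> connected (arc e).
Proof.
move=> eG; apply: connected_continuous_connected; first exact: segment_connected.
exact: arc_continuous.
Qed.

Lemma arc_pt e z : e \in edges G -> z \in e -> arc e (pt d z).
Proof.
move=> eG ze; have : (pt d @` [set` e]) (pt d z) by exists z.
rewrite -arc_ends // => -[->|->]; [exists 0|exists 1] => //=; by rewrite in_itv /= lexx ler01.
Qed.

Lemma arc_carried e s p : e \in edges G -> {subset e <= s} -> arc e p -> carried s p.
Proof.
move=> eG es [t /=]; rewrite in_itv /= => /andP[t0 t1] <-.
have E (r : R) : r = 0 \/ r = 1 -> carried s (edge_arc d e r).
  move=> r01; have : (pt d @` [set` e]) (edge_arc d e r).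
    by rewrite -arc_ends //; case: r01 => ->; [left|right].
  by move=> [z ze <-]; left; exists z => //; apply: es.
have [t0'|t0'] := eqVneq t 0; first by apply: E; left.
have [t1'|t1'] := eqVneq t 1; first by apply: E; right.
by right; exists e, t; split => //; rewrite in_itv /= !lt_neqAle eq_sym t0' t0 t1' t1.
Qed.

Lemma carried_sub s t p : {subset s <= t} -> carried s p -> carried t p.
Proof.
move=> st [[z zs ->]|[e [r [eG es r01 ->]]]]; first by left; exists z => //; exact: st.
by right; exists e, r; split => // z /es; exact: st.
Qed.

Lemma carried_disjoint s t p : {in s, forall z, z \notin t} ->
  carried s p -> carried t p -> False.
Proof.
move=> st [[z zs ->]|[e [r [eG es r01 ->]]]] [[w wt]|[f [r' [fG ft r'01]]]].
- by move=> /pt_inj zw; move: (st _ zs); rewrite zw wt.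
- by move/esym; exact: arc_vertex.
- exact: arc_vertex.
- apply: arc_disjoint => // ef; move: eG; rewrite inE => /existsP[x /existsP[y /andP[_ /eqP exy]]].
  have xe : x \in e by rewrite exy !inE eqxx.
  by move: (st _ (es _ xe)); rewrite (ft x) // -ef.
Qed.

Lemma trail_carried x s p : path (@adj G) x s -> trail x s p -> carried (x :: s) p.
Proof.
elim: s x => [|y s IH] x /=; first by move=> _ ->; left; exists x; rewrite ?mem_head.
move=> /andP[xy ys] [|/(IH _ ys)].
  apply: arc_carried; first exact: adj_edge.
  by move=> z; rewrite !inE => /orP[]->; rewrite ?orbT.
by apply: carried_sub => z zs; rewrite inE zs orbT.
Qed.

Lemma trail_start x s : path (@adj G) x s -> trail x s (pt d x).
Proof.
case: s => [//|y s] /= /andP[xy _]; left; apply: arc_pt; first exact: adj_edge.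
by rewrite !inE eqxx.
Qed.

Lemma trail_last x s : path (@adj G) x s -> trail x s (pt d (last x s)).
Proof. by elim: s x => [//|y s IH] x /= /andP[_ ys]; right; exact: IH. Qed.

Lemma trail_compact x s : path (@adj G) x s -> compact (trail x s).
Proof.
elim: s x => [|y s IH] x /=; first by move=> _; exact: compact_set1.
by move=> /andP[xy ys]; apply: compactU; [exact/arc_compact/adj_edge | exact: IH].
Qed.

Lemma trail_connected x s : path (@adj G) x s -> connected (trail x s).
Proof.
elim: s x => [|y s IH] x /=; first by move=> _; exact: connected1.
move=> /andP[xy ys]; apply: connectedU; [|exact/arc_connected/adj_edge|exact: IH].
exists (pt d y); split; last exact: trail_start.
by apply: arc_pt; [exact: adj_edge | rewrite !inE eqxx orbT].
Qed.

Lemma carried_drawn s p : carried s p -> drawn d p.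
Proof.
move=> [[z _ ->]|[e [t [eG _ t01 ->]]]]; first by left; exists z.
right; exists e => //; exists t => //=.
by move: t01; rewrite !in_itv /= => /andP[/ltW -> /ltW ->].
Qed.
End Trails.

Section Theta.
Local Open Scope classical_set_scope.

Lemma outerplanar_no_theta (R : realType) (G : sgraph) (u v : G) (s1 s2 s3 : seq G) :
  outerplanar R G -> uniq (u :: v :: s1 ++ s2 ++ s3) ->
  s1 != [::] -> s2 != [::] -> s3 != [::] ->
  path (@adj G) u (rcons s1 v) -> path (@adj G) u (rcons s2 v) ->
  path (@adj G) u (rcons s3 v) -> False.
Proof.
move=> [d [F [[[x0 Ux0 FE] _] Fcl]]] U n1 n2 n3 p1 p2 p3.
pose s j := nth [::] [:: s1; s2; s3] j.
have sn j : j < 3 -> s j != [::] by case: j => [|[|[|]]].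
have sp j : j < 3 -> path (@adj G) u (rcons (s j) v) by case: j => [|[|[|]]].
have us j : j < 3 -> u \notin s j.
  by move: U; rewrite /= inE !mem_cat !negb_or => /and3P[/and4P[_ ? ? ?] _ _]; case: j => [|[|[|]]].
have vs j : j < 3 -> v \notin s j.
  by move: U; rewrite /= !mem_cat !negb_or => /and3P[_ /and3P[? ? ?] _]; case: j => [|[|[|]]].
have uv : u != v by move: U; rewrite /= inE negb_or => /andP[/andP[]].
have sd j l z : j < 3 -> l < 3 -> j != l -> z \in s j -> z \notin s l.
  have /= : uniq (s1 ++ s2 ++ s3) by case/and3P: U.
  rewrite !cat_uniq => /and3P[_ /hasPn H1 /and3P[_ /hasPn H2 _]].
  have H12 w : w \in s2 -> w \notin s1 by move=> ws; apply: H1; rewrite mem_cat ws.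
  have H13 w : w \in s3 -> w \notin s1 by move=> ws; apply: H1; rewrite mem_cat ws orbT.
  case: j l => [|[|[|]]] // [|[|[|]]] //= _ _ _ zs.
  - by apply/negP => /H12; rewrite zs.
  - by apply/negP => /H13; rewrite zs.
  - exact: H12.
  - by apply/negP => /H2; rewrite zs.
  - exact: H13.
  - exact: H2.
(* The first inner vertices of the branches form one side of [K33]; [u], [v] and the point [x0] of
   the face form the other. *)
pose x j := head u (s j).
have sE j : j < 3 -> s j = x j :: behead (s j) by move/sn; rewrite /x; case: (s j).
have xs j : j < 3 -> x j \in s j by move=> j3; rewrite (sE _ j3) mem_head.
pose B j := rcons (behead (s j)) v.
have pA j : j < 3 -> path (@adj G) u [:: x j].
  by move=> j3; have := sp j j3; rewrite sE //= => /andP[-> _].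
have pB j : j < 3 -> path (@adj G) (x j) (B j).
  by move=> j3; have := sp j j3; rewrite sE //= => /andP[_ ->].
have mA j z : j < 3 -> z \in u :: [:: x j] -> z = u \/ z \in s j.
  by move=> j3; rewrite !inE => /orP[/eqP|/eqP->]; [left | right; exact: xs].
have mB j z : j < 3 -> z \in x j :: B j -> z = v \/ z \in s j.
  by move=> j3; rewrite -rcons_cons -sE // mem_rcons inE => /orP[/eqP|]; [left|right].
pose A j := trail d u [:: x j]; pose C j := trail d (x j) (B j).
have cM j : j < 3 -> compact (A j `|` C j).
  by move=> j3; apply: compactU; apply: trail_compact; [exact: pA | exact: pB].
have clM j : j < 3 -> closed (A j `|` C j).
  by move=> j3; apply: compact_closed; [exact: norm_hausdorff | exact: cM].
have xM i j : i < 3 -> j < 3 -> i != j -> ~ (A i `|` C i) (pt d (x j)).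
  move=> i3 j3 ij.
  have c : carried d [:: x j] (pt d (x j)) by left; exists (x j); rewrite ?mem_head.
  have xji : x j \notin s i by rewrite (sd j i) ?xs // eq_sym.
  move=> [/(trail_carried (pA i i3))|/(trail_carried (pB i i3))]; apply: carried_disjoint c => z;
    rewrite inE => /eqP->; apply/negP; [move/(mA _ _ i3)|move/(mB _ _ i3)] => -[xu|];
    by [rewrite (negbTE xji) | have := xs j j3; rewrite xu; apply/negP; auto].
(* The complement of the theta alone: it is open and contains the face. *)
pose Uo := ~` (A 0 `|` C 0) `&` ~` (A 1 `|` C 1) `&` ~` (A 2 `|` C 2).
have oU : open Uo by do 2?apply: openI; apply: closed_openC; exact: clM.
have FU : F `<=` Uo.
  move=> p; rewrite FE => /connected_component_sub nd.
  have H j : j < 3 -> ~ (A j `|` C j) p.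
    by move=> j3 [/(trail_carried (pA j j3))|/(trail_carried (pB j j3))] /carried_drawn.
  by split; [split|]; exact: H.
have UoM j p : j < 3 -> Uo p -> ~ (A j `|` C j) p.
  by move=> + [[]]; case: j => [|[|[|]]].
have cF : connected F by rewrite FE; exact: component_connected.
have Fx0 : F x0 by rewrite FE; exact: connected_component_refl.
(* [D j] runs inside [Uo] from [x0] to a point [f] of the face near [x j], then along a segment in a
   ball around [x j] that misses the other branches. *)
have /choice[D HD] (j : nat) : exists D : set (R * R), j < 3 ->
   [/\ compact D, connected D, D x0 & D (pt d (x j))] /\
   forall i, i < 3 -> i != j -> (A i `|` C i) `&` D = set0.
  case: (ltnP j 3) => j3; last by exists set0.
  have : \forall p \near pt d (x j), forall i : 'I_3, i != j :> nat -> ~ (A i `|` C i) p.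
    pose f (i : 'I_3) : set (R * R) := [set p | i != j :> nat -> ~ (A i `|` C i) p].
    apply: (@filter_forall _ _ f (nbhs (pt d (x j)))) => i; rewrite /f /=.
    case: (boolP (i != j :> nat)) => ij; last by near=> p.
    have : nbhs (pt d (x j)) (~` (A i `|` C i)).
      by apply: open_nbhs_nbhs; split; [exact/closed_openC/clM | exact: xM].
    by apply: filterS => p H _.
  move=> /nbhs_ballP[e /= e0 He].
  have [f [Ff xf]] := Fcl (x j) _ (nbhsx_ballx (pt d (x j)) e e0).
  have [L [cL nL LU Lx0 Lf]] := connected_joined cF oU FU Fx0 Ff.
  exists (L `|` segment (pt d (x j)) f) => _; split; first split.
  - by apply: compactU => //; exact: compact_segment.
  - by apply: connectedU => //; [exists f; split => //; exact: segmentr | exact: connected_segment].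
  - by left.
  - by right; exact: segmentl.
  - move=> i i3 ij; apply/seteqP; split => // p [Mp [Lp|Sp]].
      exact: (UoM i p i3 (LU _ Lp)).
    exact: (He p (segment_ball xf Sp) (Ordinal i3)).
(* The defaults of [nth] supply the third row: [a 2] is [x0], and [K 2 j] below is [D j]. *)
pose a i := nth x0 [:: pt d u; pt d v] i.
(* [D j] may meet [A j] and [C j], since these edges of [K33] share the end [x j];
   so [x j] need not be accessible by an arc inside the outer face. *)
pose K i j := nth (D j) [:: A j; C j] i.
apply: (@K33_nonplanar R a (fun j => pt d (x j)) K).
- move=> i j; case: i => [|[|[|]]] // _ j3; rewrite /K /a /=.
  + split; [exact/trail_compact/pA|exact/trail_connected/pA|exact/trail_start/pA|].
    exact/trail_last/pA.
  + split; [exact/trail_compact/pB|exact/trail_connected/pB| |exact/trail_start/pB].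
    by have := trail_last d (pB j j3); rewrite last_rcons.
  + by have [[]] := HD j j3.
- move=> i k j l /andP[+ +]; case: k => [|[|[|]]] //; case: i => [|[|]] //= _ _ j3 l3 jl; rewrite /K /=.
  + apply/seteqP; split => // p [/(trail_carried (pA j j3)) H1 /(trail_carried (pB l l3)) H2].
    apply: carried_disjoint H1 H2 => z /(mA _ _ j3) zj; apply/negP => /(mB _ _ l3) zl.
    case: zj zl => [->|zj] [zl|zl].
    * by move: uv; rewrite zl eqxx.
    * by move: (us l l3); rewrite zl.
    * by move: (vs j j3); rewrite -zl zj.
    * by move: (sd j l z j3 l3 jl zj); rewrite zl.
  + by have [_ /(_ j j3 jl)] := HD l l3; rewrite setIUl setU_eq0 => -[].
  + by have [_ /(_ j j3 jl)] := HD l l3; rewrite setIUl setU_eq0 => -[].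
Unshelve. all: by end_near. Qed.
End Theta.

(** * Noncrossing orders *)

Section Paths.
Variable G : sgraph.
Implicit Types (x y u v w : G) (p q s C : seq G).
Notation adj := (@adj G).

Lemma rev_adj_path x s y : path adj x (rcons s y) -> path adj y (rcons (rev s) x).
Proof.
have := rev_path adj x (rcons s y); rewrite last_rcons belast_rcons rev_cons => ->.
by apply: sub_path => a b; rewrite adj_sym.
Qed.

Lemma cycle_cat2 x s y t :
  cycle adj (x :: s ++ y :: t) = path adj x (rcons s y) && path adj y (rcons t x).
Proof. by rewrite /= rcons_cat /= cat_path rcons_path /= andbA. Qed.

Lemma path_exit C x p : path adj x p -> x \in C -> last x p \notin C ->
  exists u w, [/\ u \in C, w \notin C & adj u w].
Proof.
elim: p x => [x _ /= -> //|y p IH] x /= /andP[xy yp] xC lC.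
have [yC|yC] := boolP (y \in C); first exact: IH yp yC lC.
by exists x, y.
Qed.

Lemma path_first_hit C w p : path adj w p -> w \notin C -> last w p \in C ->
  exists p1 v p2, [/\ p = p1 ++ v :: p2, v \in C & all [predC C] (w :: p1)].
Proof.
elim: p w => [w _ /= /negP // |y p IH] w /= /andP[xy yp] wC lC.
have [yC|yC] := boolP (y \in C); first by exists [::], y, p; rewrite /= wC.
have [p1 [v [p2 [-> vC ap]]]] := IH _ yp yC lC.
by exists (y :: p1), v, p2; rewrite /= wC; split.
Qed.

Lemma path_without (u x y : G) : k_connected G 2 -> x != u -> y != u ->
  exists p, [/\ path adj x p, last x p = y, uniq (x :: p) & u \notin x :: p].
Proof.
move=> [_ /(_ [set u])]; rewrite cards1 => /(_ isT) H xu yu.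
have /connectP[p xp ->] : connect [rel u0 v0 : G | [&& u0 \notin [set u], v0 \notin [set u] & adj u0 v0]] x y.
  by apply: H; rewrite inE.
case/shortenP: xp => q xq Uq _; exists q; split => //.
  by apply: sub_path xq => a b /= /and3P[].
move: xu; rewrite inE negb_or eq_sym => -> /=.
elim: q x xq {Uq p} => [//|z q IH] x /= /andP[/and3P[_ + _] zq].
by rewrite !inE negb_or eq_sym => ->; exact: IH zq.
Qed.

(** Two neighbours of [v] are joined by a path avoiding [v], which closes up through [v]. *)
Lemma exists_cycle v : k_connected G 2 -> 1 < #|neighbours v| -> exists p : seq G, is_cycle p.
Proof.
move=> H2 /card_gt1P[x [y [+ + xy]]]; rewrite !inE => vx vy.
have nv z : adj v z -> z != v by apply: contraTneq => ->; rewrite adj_irr.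
have [p [xp lp Up vp]] := path_without H2 (nv _ vx) (nv _ vy).
exists (v :: x :: p); rewrite /is_cycle /ucycleb.
case: p xp lp Up vp => [|z p] xp lp Up vp; first by move: xy; rewrite -lp eqxx.
rewrite cons_uniq vp Up /= -/(path _ _ (z :: p)) vx rcons_path.
by move: xp lp => /= /andP[-> ->] /= ->; rewrite adj_sym vy.
Qed.

Lemma longest_cycle : (exists p : seq G, is_cycle p) ->
  exists2 p : seq G, is_cycle p & forall q : seq G, is_cycle q -> size q <= size p.
Proof.
(* Tuples of a fixed length form a finite type, so [P] is boolean; a cycle repeats no vertex, so its
   length is at most [#|G|]. *)
move=> [p0 cp0]; pose P n := [exists t : n.-tuple G, is_cycle t].
have PP p : is_cycle p -> P (size p) by move=> cp; apply/existsP; exists (in_tuple p).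
have ub n : P n -> n <= #|G|.
  move=> /existsP[t /andP[_ /andP[_ Ut]]].
  by rewrite -(size_tuple t) -(card_uniqP Ut) max_card.
have exP : exists n, P n by exists (size p0); exact: PP.
case: (ex_maxnP exP ub) => n /existsP[t ct] Hn; exists t => // q /PP /Hn.
by rewrite size_tuple.
Qed.

End Paths.

Section Outerplane.
Variable G : sgraph.
Notation adj := (@adj G).
Hypothesis no_theta : forall (u v : G) (s1 s2 s3 : seq G),
  uniq (u :: v :: s1 ++ s2 ++ s3) -> s1 != [::] -> s2 != [::] -> s3 != [::] ->
  path adj u (rcons s1 v) -> path adj u (rcons s2 v) -> path adj u (rcons s3 v) -> False.

(** A vertex off [C] yields an edge from [u] on [C] to [w] off [C], and a path from [w] avoiding [u]
    meets [C] again, first at some [v]. If an arc of [C] between [u] and [v] has no inner vertex,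
    the detour through [w] replaces it and lengthens the cycle; otherwise the detour and the two
    arcs form a theta. *)
Lemma longest_cycle_spanning (C : seq G) : k_connected G 2 -> is_cycle C ->
  (forall q : seq G, is_cycle q -> size q <= size C) -> forall x, x \in C.
Proof.
move=> H2 cC maxC x; apply/negPn/negP => xC.
have [u0 u0C] : exists u0, u0 \in C.
  by move: cC => /andP[]; case: (C) => // a ? _ _; exists a; rewrite mem_head.
have [p up lp] : exists2 p, path adj u0 p & last u0 p = x.
  (* With nothing removed, 2-connectedness gives plain connectedness. *)
  have [_ /(_ finset.set0)] := H2; rewrite cards0 => /(_ isT u0 x).
  rewrite !inE => /(_ isT isT) /connectP[p up ->]; exists p => //.
  by apply: sub_path up => a b /= /and3P[].
have [u [w [uC wC uw]]] : exists u w, [/\ u \in C, w \notin C & adj u w].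
  by apply: path_exit up u0C _; rewrite lp.
have [i C' rC] := rot_to uC.
have cC' : ucycleb adj (u :: C') by rewrite /ucycleb -rC rot_cycle rot_uniq; case/andP: cC.
have sC : size C = (size C').+1 by rewrite -(size_rot i C) rC.
have mC z : (z \in C) = (z \in u :: C') by rewrite -rC mem_rot.
have [c1 c1C c1u] : exists2 c1, c1 \in C & c1 != u.
  case/andP: (cC); rewrite sC; case: (C') (mC) cC' => [|c l] // mC' /andP[_ /=].
  rewrite inE negb_or eq_sym => /andP[/andP[cu _] _] _ _.
  by exists c => //; rewrite mC' !inE eqxx orbT.
have wu : w != u by apply: contraNneq wC => ->.
have [q [wq lq Uq uq]] := path_without H2 wu c1u.
have [p1 [v [p2 [Eq vC ap]]]] : exists p1 v p2, [/\ q = p1 ++ v :: p2, v \in C & all [predC C] (w :: p1)].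
  by apply: path_first_hit wq wC _; rewrite lq.
have vu : v != u.
  by apply: contraNneq uq => <-; rewrite Eq inE mem_cat mem_head !orbT.
have wv : path adj w (rcons p1 v) by move: wq; rewrite Eq -cat_rcons cat_path => /andP[].
have Uw : uniq (w :: p1) by move: Uq; rewrite Eq -cat_cons cat_uniq => /andP[].
have vC' : v \in C' by move: vC; rewrite mC inE (negbTE vu).
move: cC' sC mC => {rC}; case/splitPr: vC' => A B /andP[cAB UAB] sC mC.
move: cAB; rewrite cycle_cat2 => /andP[pA pB].
have pW : path adj u (rcons (w :: p1) v) by rewrite /= uw.
have U4 : uniq (u :: v :: (w :: p1) ++ A ++ B).
  suff : uniq ((w :: p1) ++ (u :: A ++ v :: B)).
    rewrite (@perm_uniq _ _ (u :: v :: (w :: p1) ++ A ++ B)) //.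
    apply/permP => P; do 5 rewrite /= ?count_cat ?count_rev; ring.
  rewrite cat_uniq Uw UAB andbT; apply/hasPn => z; rewrite -mC => zC.
  by apply/negP => /(allP ap) /=; rewrite zC.
have long D : uniq D -> cycle adj D -> size D = (size p1).+1 + size C -> False.
  move=> UD cD sD; have : is_cycle D.
    rewrite /is_cycle /ucycleb cD UD sD !andbT; case/andP: cC => c2 _.
    exact: leq_trans c2 (leq_addl _ _).
  by move/maxC; rewrite sD -[X in _ <= X]add0n leq_add2r.
have [A0|An] := eqVneq A [::].
  apply: (long (u :: (w :: p1) ++ v :: B)).
  - rewrite (@perm_uniq _ _ (u :: v :: (w :: p1) ++ A ++ B)) // A0.
    by apply/permP => P; do 5 rewrite /= ?count_cat ?count_rev; ring.
  - by rewrite cycle_cat2 pW pB.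
  - by rewrite sC A0 /= !size_cat /=; ring.
have [B0|Bn] := eqVneq B [::].
  apply: (long (u :: A ++ v :: rev (w :: p1))).
  - rewrite (@perm_uniq _ _ (u :: v :: (w :: p1) ++ A ++ B)) // B0.
    by apply/permP => P; do 5 rewrite /= ?count_cat ?count_rev; ring.
  - by rewrite cycle_cat2 pA rev_adj_path.
  - by rewrite sC B0 /= !size_cat /= size_rev /=; ring.
apply: (no_theta (u := u) (v := v) (s1 := w :: p1) (s2 := A) (s3 := rev B)) => //.
- rewrite (@perm_uniq _ _ (u :: v :: (w :: p1) ++ A ++ B)) //.
  by apply/permP => P; do 5 rewrite /= ?count_cat ?count_rev; ring.
- by rewrite -size_eq0 size_rev size_eq0.
- exact: rev_adj_path.
Qed.

(** The theta has ends [a] and [b]. Its branches are [A]; the chord to [c] followed by [B]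
    backwards; and [E] backwards, then [d] and the chord to [b]. *)
Lemma no_crossing_nonempty (a b c d : G) A B D E :
  uniq ([:: a; b; c; d] ++ A ++ B ++ D ++ E) ->
  path adj a (rcons A b) -> path adj b (rcons B c) -> path adj d (rcons E a) ->
  adj a c -> adj b d -> A != [::] -> False.
Proof.
move=> U pA pB pE ac bd An.
apply: (no_theta (u := a) (v := b) (s1 := A) (s2 := c :: rev B) (s3 := rev (d :: E))) => //.
- have : uniq (([:: a; b; c; d] ++ A ++ B ++ E) ++ D).
    rewrite (@perm_uniq _ _ ([:: a; b; c; d] ++ A ++ B ++ D ++ E)) //.
    by apply/permP => P; do 5 rewrite /= ?count_cat ?count_rev; ring.
  rewrite cat_uniq => /andP[+ _]; congr (is_true _); apply: perm_uniq.
  apply/permP => P; rewrite rev_cons -cats1; do 5 rewrite /= ?count_cat ?count_rev; ring.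
- by rewrite -size_eq0 size_rev.
- by rewrite /= ac rev_adj_path.
- by rewrite rev_cons rcons_path rev_adj_path //= last_rcons adj_sym.
Qed.

(** More than four vertices leave some arc nonempty, and a rotation puts it first. With only four,
    the chords would give [K4], which is too small for such a theta. *)
Lemma no_crossing (a b c d : G) A B D E :
  uniq (a :: A ++ b :: B ++ c :: D ++ d :: E) ->
  cycle adj (a :: A ++ b :: B ++ c :: D ++ d :: E) ->
  4 < size (a :: A ++ b :: B ++ c :: D ++ d :: E) ->
  adj a c -> adj b d -> False.
Proof.
move=> U; rewrite cycle_cat2 => /andP[pA].
rewrite rcons_cat rcons_cons -cat_rcons cat_path last_rcons => /andP[pB].
rewrite rcons_cat rcons_cons -cat_rcons cat_path last_rcons => /andP[pD pE] sz ac bd.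
have ca : adj c a by rewrite adj_sym.
have db : adj d b by rewrite adj_sym.
have perm s : perm_eq (a :: A ++ b :: B ++ c :: D ++ d :: E) s -> uniq s.
  by move/perm_uniq <-.
have [A0|An] := eqVneq A [::]; last first.
  apply: (no_crossing_nonempty (A := A) (B := B) (D := D) (E := E) _ pA pB pE) => //.
  by apply: perm; apply/permP => P; do 5 rewrite /= ?count_cat ?count_rev; ring.
have [B0|Bn] := eqVneq B [::]; last first.
  apply: (no_crossing_nonempty (A := B) (B := D) (D := E) (E := A) _ pB pD pA) => //.
  by apply: perm; apply/permP => P; do 5 rewrite /= ?count_cat ?count_rev; ring.
have [D0|Dn] := eqVneq D [::]; last first.
  apply: (no_crossing_nonempty (A := D) (B := E) (D := A) (E := B) _ pD pE pB) => //.
  by apply: perm; apply/permP => P; do 5 rewrite /= ?count_cat ?count_rev; ring.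
have [E0|En] := eqVneq E [::]; last first.
  apply: (no_crossing_nonempty (A := E) (B := A) (D := B) (E := D) _ pE pA pD) => //.
  by apply: perm; apply/permP => P; do 5 rewrite /= ?count_cat ?count_rev; ring.
by move: sz; rewrite A0 B0 D0 E0.
Qed.

(** Cutting at [x] keeps the relative order of later elements, so the ends of two chords can be
    split off one after another. *)
Lemma index_split (T : eqType) (s : seq T) x : uniq s -> x \in s ->
  exists s1 s2, s = s1 ++ x :: s2 /\
  forall y z, z \in s -> index x s < index z s ->
    z \in s2 /\ (index y s < index z s -> index x s < index y s -> index y s2 < index z s2).
Proof.
move=> + xs; case/splitPr: xs => s1 s2 Us; exists s1, s2; split => //.
have xs1 : x \notin s1.
  by move: Us; rewrite cat_uniq /= negb_or => /and3P[_ /andP[]].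
have ix : index x (s1 ++ x :: s2) = size s1 by rewrite index_cat (negbTE xs1) /= eqxx addn0.
have iz z : size s1 < index z (s1 ++ x :: s2) ->
    z \notin s1 /\ index z (s1 ++ x :: s2) = (size s1 + (index z s2).+1)%N.
  rewrite index_cat; case: ifP => [zs1|_]; first by rewrite ltnNge ltnW // index_mem.
  by move=> /=; case: eqP => // _; rewrite addn0 ltnn.
move=> y z zs; rewrite ix => lz; have [zs1 Ez] := iz z lz; split.
  move: zs; rewrite mem_cat (negbTE zs1) inE /=; case: eqVneq => // zx.
  by move: lz; rewrite zx ix ltnn.
by rewrite Ez => + ly; have [_ ->] := iz y ly; rewrite ltn_add2l ltnS.
Qed.

Lemma index_noncrossing (C : seq G) : is_cycle C -> 4 < size C ->
  forall a b c d : G, index a C < index b C -> index b C < index c C ->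
    index c C < index d C -> d \in C -> adj a c -> adj b d -> False.
Proof.
move=> /andP[_ /andP[cC UC]] sC a b c d ab bc cd dC.
have mem x : index x C < index d C -> x \in C.
  by rewrite -!index_mem in dC * => /ltn_trans; apply.
have bd := ltn_trans bc cd; have ad := ltn_trans ab bd.
have aC := mem a ad; have bC := mem b bd; have cC' := mem c cd.
have [s1 [s2 [E2 H2]]] := index_split UC aC.
have [b2 _] := H2 b b bC ab.
have [c2 /(_ bc ab) bc2] := H2 b c cC' (ltn_trans ab bc).
have [d2 /(_ cd (ltn_trans ab bc)) cd2] := H2 c d dC ad.
have U2 : uniq s2 by move: UC; rewrite E2 cat_uniq /= => /and4P[].
have [A [s3 [E3 H3]]] := index_split U2 b2.
have [c3 _] := H3 b c c2 bc2.
have [d3 /(_ cd2 bc2) cd3] := H3 c d d2 (ltn_trans bc2 cd2).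
have U3 : uniq s3 by move: U2; rewrite E3 cat_uniq /= => /and4P[].
have [B [s4 [E4 H4]]] := index_split U3 c3.
have [d4 _] := H4 c d d3 cd3.
move: E4; case/splitPr: d4 => D E E4.
(* The part of [C] before [a] moves behind the last arc. *)
have Er : rot (size s1) C = a :: A ++ b :: B ++ c :: D ++ d :: (E ++ s1).
  by rewrite {1}E2 rot_size_cat E3 E4; do 4 rewrite /= -?catA.
apply: (no_crossing (a := a) (b := b) (c := c) (d := d) (A := A) (B := B) (D := D) (E := E ++ s1)).
- by rewrite -Er rot_uniq.
- by rewrite -Er rot_cycle.
- by rewrite -Er size_rot.
Qed.

(** The order is the position along a longest cycle, injective because that cycle is spanning. The
    girth makes it longer than four, as [no_crossing] requires. *)
Lemma noncrossing_order : k_connected G 2 -> 3 < max_degree G -> girth_ge G 6 ->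
  exists2 f : G -> nat, injective f &
  forall a b c d, f a < f b -> f b < f c -> f c < f d -> adj a c -> adj b d -> False.
Proof.
move=> H2 md g6.
have [v dv] : exists v : G, 1 < #|neighbours v|.
  case: (boolP [exists v : G, 1 < #|neighbours v|]) => [/existsP//|].
  rewrite negb_exists => /forallP H.
  suff : max_degree G <= 1 by rewrite leqNgt (leq_trans _ md).
  by apply/bigmax_leqP => v _; move: (H v); rewrite -leqNgt.
have [C cC maxC] := longest_cycle (exists_cycle H2 dv).
have sC := longest_cycle_spanning H2 cC maxC.
exists (index^~ C); first by move=> x y; apply: index_inj.
move=> a b c d ab bc cd; apply: (index_noncrossing cC _ ab bc cd) => //.
exact: leq_trans (g6 _ cC).
Qed.
End Outerplane.

(** * Threads of vertices of degree two *)

Section Reducible.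
Variables (G : sgraph) (f : G -> nat).
Notation adj := (@adj G).
Hypothesis f_inj : injective f.
Hypothesis f_noncrossing : forall a b c d,
  f a < f b -> f b < f c -> f c < f d -> adj a c -> adj b d -> False.

Definition nbrs (S : {set G}) (x : G) : {set G} := neighbours x :&: S.

Lemma mem_nbrs S x y : (y \in nbrs S x) = adj x y && (y \in S).
Proof. by rewrite !inE. Qed.

(** The counterpart in [S] of a chord that cuts off some vertex. The ends are taken in increasing
    order, so [f p.2 - f p.1] measures the span. *)
Definition wide (S : {set G}) (p : G * G) : bool :=
  [&& p.1 \in S, p.2 \in S, adj p.1 p.2, f p.1 < f p.2
    & [exists k in S, f p.1 < f k < f p.2]].

(** The first vertex of [S] has two later neighbours; the edge to the farther one passes over the
    nearer. *)
Lemma exists_wide (S : {set G}) x0 : x0 \in S -> {in S, forall x, 1 < #|nbrs S x|} ->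
  exists p, wide S p.
Proof.
move=> x0S degS; have [m mS' minm] := arg_minnP f x0S.
have mS : m \in S by exact: mS'.
have lt_m y : y \in S -> y != m -> f m < f y.
  by move=> yS ym; rewrite ltn_neqAle minm // andbT (inj_eq f_inj) eq_sym.
have /card_gt1P[y [z []]] := degS m mS.
rewrite !mem_nbrs => /andP[my yS] /andP[mz zS] yz.
have nm w : adj m w -> w != m by apply: contraTneq => ->; rewrite adj_irr.
have my' := lt_m _ yS (nm _ my); have mz' := lt_m _ zS (nm _ mz).
case: (ltngtP (f y) (f z)) => [lt|lt|/f_inj/eqP]; last by rewrite (negbTE yz).
- by exists (m, z); rewrite /wide /= mS zS mz mz' /=; apply/existsP; exists y; rewrite yS my'.
- by exists (m, y); rewrite /wide /= mS yS my my' /=; apply/existsP; exists z; rewrite zS mz'.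
Qed.

(* By minimality, the vertices of [S] between the ends of a minimal wide edge are
   only adjacent to their neighbours in the order. *)
Lemma degree2_thread (S : {set G}) x0 : girth_ge G 6 -> x0 \in S ->
  {in S, forall x, 1 < #|nbrs S x|} ->
  exists t : nat -> G,
    [/\ {in gtn 6 &, injective t}, forall k, k < 6 -> t k \in S &
     forall k, 0 < k < 5 -> nbrs S (t k) = [set t k.-1; t k.+1]].
Proof.
move=> g6 x0S degS; have [p0 wp0] := exists_wide x0S degS.
have [[i j] wij minij] := arg_minnP (fun p => f p.2 - f p.1) wp0.
move: (wij) => /and5P[/= iS jS ij lt_ij /existsP[k0 /and3P[k0S ik0 k0j]]].
(* The part cut off by a wide edge of least span, ends included; listed in order by [s], it is the
   boundary of a face. *)
pose I := [set k in S | f i <= f k <= f j].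
pose s := sort (relpre f leq) (enum I).
have ms z : (z \in s) = (z \in I) by rewrite mem_sort mem_enum.
have Us : uniq s by rewrite sort_uniq enum_uniq.
have ss : sorted (relpre f ltn) s.
  rewrite -sorted_map ltn_sorted_uniq_leq map_inj_uniq // Us sorted_map.
  by apply: sort_sorted => a b; exact: leq_total.
pose t k := nth i s k; pose n := size s.
have tlt k l : k < l -> l < n -> f (t k) < f (t l).
  move=> kl ln; apply: (sorted_ltn_nth _ _ ss) => //.
    by move=> a b c; exact: ltn_trans.
  exact: ltn_trans ln.
have tinj k l : k < n -> l < n -> t k = t l -> k = l.
  by move=> kn ln /eqP; rewrite nth_uniq // => /eqP.
have tI k : k < n -> t k \in I by move=> kn; rewrite -ms mem_nth.
have tE z : z \in I -> exists2 k, k < n & z = t k.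
  by rewrite -ms => zs; exists (index z s); rewrite ?index_mem // /t nth_index.
have tb k : k < n -> f i <= f (t k) <= f j by move/tI; rewrite inE => /andP[].
have tS k : k < n -> t k \in S by move/tI; rewrite inE => /andP[].
have iI : i \in I by rewrite inE iS leqnn ltnW.
have jI : j \in I by rewrite inE jS leqnn ltnW.
have k0I : k0 \in I by rewrite inE k0S (ltnW ik0) (ltnW k0j).
have n0 : 0 < n by have [k kn _] := tE _ iI; exact: leq_ltn_trans kn.
have t0 : t 0 = i.
  have [[|k] kn Ei] := tE _ iI => //.
  by have := tlt 0 k.+1 isT kn; rewrite -Ei ltnNge; have /andP[-> _] := tb 0 n0.
have n1 : n.-1 < n by rewrite prednK.
have tn : t n.-1 = j.
  have [k kn Ej] := tE _ jI.
  have [->|kn'] := eqVneq n.-1 k; first by [].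
  have lt : k < n.-1 by rewrite ltn_neqAle eq_sym kn' -ltnS prednK.
  have := tlt _ _ lt n1; rewrite -Ej ltnNge.
  by have /andP[_ ->] := tb _ n1.
have n3 : 2 < n.
  have [k kn Ek] := tE _ k0I.
  have k_gt0 : k != 0 by apply: contraTneq ik0 => k0'; rewrite Ek k0' t0 ltnn.
  have kn1 : k != n.-1 by apply: contraTneq k0j => k0'; rewrite Ek k0' tn ltnn.
  by move: kn k_gt0 kn1; clear; lia.
(* Noncrossing with the edge from [i] to [j] confines the neighbours of [t k] to [I], minimality
   leaves only the two adjacent positions, and the degree bound forces both. *)
have inner k : 0 < k -> k.+1 < n -> nbrs S (t k) = [set t k.-1; t k.+1].
  move=> k0' kn; have kn' := ltnW kn.
  have ik : f i < f (t k) by rewrite -t0; exact: tlt.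
  have kj : f (t k) < f j by rewrite -tn; apply: tlt n1; rewrite ltn_predRL.
  have kS := tS k kn'.
  apply/eqP; rewrite eqEcard cards2 (leq_trans _ (degS _ kS)) ?andbT; last by case: (_ != _).
  apply/fintype.subsetP => y; rewrite mem_nbrs => /andP[ky yS].
  have yI : y \in I.
    rewrite inE yS /=; apply/andP; split; rewrite leqNgt; apply/negP => lt.
      by apply: (f_noncrossing lt ik kj) => //; rewrite adj_sym.
    exact: (f_noncrossing ik kj lt).
  have [l ln Ey] := tE _ yI; rewrite Ey in ky yS *.
  (* Apart from the edge joining [i] and [j], an edge between nonconsecutive positions would be wide
     with a smaller span. *)
  have nw a b : a < n -> b < n -> a.+1 < b -> 0 < a \/ b < n.-1 -> adj (t a) (t b) -> False.
    move=> an bn ab inn adjab.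
    have : wide S (t a, t b).
      rewrite /wide /= !tS // adjab tlt ?(ltnW ab) //=.
      by apply/existsP; exists (t a.+1); rewrite tS ?tlt //; apply: ltn_trans bn.
    move/minij => /=; rewrite -t0 -tn.
    have := tlt _ _ (ltnW ab) bn.
    case: inn => inn.
      have := tlt _ _ inn an.
      have : f (t b) <= f (t n.-1) by rewrite tn; case/andP: (tb _ bn).
      move: (f (t a)) (f (t b)) (f (t 0)) (f (t n.-1)); clear; lia.
    have := tlt _ _ inn n1.
    have : f (t 0) <= f (t a) by rewrite t0; case/andP: (tb _ an).
    move: (f (t a)) (f (t b)) (f (t 0)) (f (t n.-1)); clear; lia.
  have lk : l != k by apply: contraTneq ky => ->; rewrite adj_irr.
  rewrite !inE.
  have [kl|kl] := ltnP k.+1 l.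
    by case: (nw k l) => //; left.
  have [lk'|lk'] := ltnP l.+1 k.
    by case: (nw l k) => //; [right; rewrite ltn_predRL | rewrite adj_sym].
  have [->|->] : l = k.-1 \/ l = k.+1 by move: kl lk' lk k0'; clear; lia.
    by rewrite eqxx.
  by rewrite eqxx orbT.
have tadj k : k.+1 < n -> adj (t k) (t k.+1).
  case: k => [|k] kn.
    have : t 0 \in nbrs S (t 1) by rewrite inner // !inE eqxx.
    by rewrite mem_nbrs adj_sym => /andP[].
  have : t k.+2 \in nbrs S (t k.+1) by rewrite inner // !inE eqxx orbT.
  by rewrite mem_nbrs => /andP[].
(* The path along [t] is closed by the edge from [j] to [i], so the girth bounds its length. *)
have n6 : 6 <= n.
  apply: g6; rewrite /is_cycle /ucycleb n3 Us andbT.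
  have [a [s' Es]] : exists a s', s = a :: s' by move: n0; rewrite /n; case: (s) => // a s' _; exists a, s'.
  have Ea : a = t 0 by rewrite /t Es.
  have El : last a s' = t n.-1 by rewrite /t /n nth_last Es.
  rewrite Es /= rcons_path El Ea t0 tn adj_sym ij andbT -t0 -Ea.
  apply/(pathP i) => k ks'.
  have := tadj k; rewrite /t /n Es /= ltnS => /(_ ks').
  by case: k ks'.
exists t; split.
- by move=> k l; rewrite !inE => k6 l6; apply: tinj; apply: leq_trans n6.
- by move=> k k6; apply: tS; apply: leq_trans n6.
- by move=> k /andP[k0' k5]; apply: inner => //; apply: leq_trans n6.
Qed.
End Reducible.

(** * Extending colorings *)

Section Coloring.
Variables (G : sgraph) (K : nat).
Notation adj := (@adj G).
Hypothesis K6 : 6 <= K.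
Hypothesis degK : forall v : G, #|neighbours v| + 2 <= K.
Implicit Types (S : {set G}) (a b : G -> 'I_K) (x y z u v w : G).

(* A (k,1)-coloring amounts to the color [a v] of each vertex [v] together with
   the common color [b v] of the incidences in [I2 v]. *)
Definition good S a b : Prop :=
  [/\ {in S, forall x, a x != b x},
      {in S &, forall x y, adj x y -> [&& a x != a y, b x != b y & a x != b y]} &
      {in S, forall w, {in nbrs S w &, forall x y, x != y -> b x != b y}}].

Definition colorable S : Prop := exists a b, good S a b.

Lemma avoid_colors (s : seq 'I_K) : size s < K -> exists c, c \notin s.
Proof.
move=> sK; case: (pickP [predC s]) => [c cs|none]; first by exists c.
suff : K <= size s by rewrite leqNgt sK.
rewrite -{1}(card_ord K); apply: leq_trans (card_size s).
by apply/fintype.subset_leq_card/fintype.subsetP => c _; move: (none c) => /negbFE.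
Qed.

Lemma adj_neq x y : adj x y -> x != y.
Proof. by apply: contraTneq => ->; rewrite adj_irr. Qed.

(** Since [x] is a neighbour of [u] outside [S], the excluded colors number at most
    [#|neighbours u| + 1], which is less than [K]. *)
Lemma pendant_color S a b u x : x \notin S -> adj u x ->
  exists c, [/\ c != a u, c != b u & {in nbrs S u, forall z, c != b z}].
Proof.
move=> xS ux.
have lt : #|nbrs S u| < #|neighbours u|.
  apply: proper_card; apply/properP; split; first exact: subsetIl.
  by exists x; rewrite !inE ?ux // (negbTE xS).
have [|c] := @avoid_colors (a u :: b u :: [seq b z | z <- enum (nbrs S u)]).
  by rewrite /= size_map -cardE; have := degK u; move: lt; clear; lia.
rewrite !inE !negb_or => /and3P[cau cbu /mapP H]; exists c; split => // z zu.
by apply/eqP => cz; apply: H; exists z; rewrite ?mem_enum.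
Qed.

(** Only a single neighbour [u] constrains [x]: [b x] comes from [pendant_color], and [a x] then has
    three colors to avoid. *)
Lemma colorable_leaf S x : x \in S -> #|nbrs S x| <= 1 -> colorable (S :\ x) -> colorable S.
Proof.
move=> xS nx [a [b [g1 g2 g3]]]; pose S' := S :\ x.
have xS' : x \notin S' by rewrite !inE eqxx.
have oneN u u' : u \in nbrs S x -> u' \in nbrs S x -> u = u'.
  by move=> ux u'x; apply/eqP/negPn/negP => neq; move: nx; rewrite leqNgt;
     apply/negP/negPn/card_gt1P; exists u, u'.
have [cb [ca [cab Hc]]] : exists cb ca, ca != cb /\ forall u, u \in nbrs S x ->
    [/\ [&& cb != a u, cb != b u, ca != a u & ca != b u] & {in nbrs S' u, forall z, cb != b z}].
  have [N0|[u ux]] := set_0Vmem (nbrs S x).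
    have [//|cb _] := @avoid_colors [::]; first by rewrite (leq_trans _ K6).
    have [|ca] := @avoid_colors [:: cb]; first by rewrite (leq_trans _ K6).
    by rewrite inE => cab; exists cb, ca; split => // u; rewrite N0 inE.
  have xu : adj u x by move: ux; rewrite mem_nbrs adj_sym => /andP[].
  have [cb [h1 h2 h3]] := @pendant_color S' a b u x xS' xu.
  have [|ca] := @avoid_colors [:: cb; a u; b u]; first by rewrite (leq_trans _ K6).
  rewrite !inE !negb_or => /and3P[cab h4 h5]; exists cb, ca; split => // u' u'x.
  by rewrite (oneN _ _ u'x ux) h1 h2 h4 h5; split.
pose a' z := if z == x then ca else a z; pose b' z := if z == x then cb else b z.
have a'x : a' x = ca by rewrite /a' eqxx.
have b'x : b' x = cb by rewrite /b' eqxx.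
have a'E z : z != x -> a' z = a z by move=> /negbTE zx; rewrite /a' zx.
have b'E z : z != x -> b' z = b z by move=> /negbTE zx; rewrite /b' zx.
have inS' z : z \in S -> z != x -> z \in S' by move=> zS zx; rewrite !inE zx.
exists a', b'; split.
- move=> z zS; have [->|zx] := eqVneq z x; first by rewrite a'x b'x.
  by rewrite a'E // b'E //; apply: g1; exact: inS'.
- move=> z y zS yS zy.
  have [zx|zx] := eqVneq z x.
    have yx : y != x by rewrite -zx eq_sym adj_neq.
    have [|/and4P[h1 h2 h3 h4] _] := Hc y; first by rewrite mem_nbrs -zx zy.
    by rewrite zx a'x b'x a'E // b'E // h2 h3 h4.
  have [yx|yx] := eqVneq y x.
    have [|/and4P[h1 h2 h3 h4] _] := Hc z; first by rewrite mem_nbrs -yx adj_sym zy.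
    by rewrite yx a'x b'x a'E // b'E // !(eq_sym _ ca) !(eq_sym _ cb) h2 h3 h1.
  by rewrite !a'E // !b'E //; apply: g2 => //; exact: inS'.
- move=> w wS y z; rewrite !mem_nbrs => /andP[wy yS] /andP[wz zS] yz.
  have new z' : adj w x -> z' \in S -> adj w z' -> z' != x -> b' z' != b' x.
    move=> wx z'S wz' z'x; have [|_ H] := Hc w; first by rewrite mem_nbrs adj_sym wx.
    by rewrite b'x b'E // eq_sym H // mem_nbrs wz' inS'.
  have [yx|yx] := eqVneq y x; first by rewrite eq_sym yx; apply: new; rewrite -?yx // eq_sym.
  have [zx|zx] := eqVneq z x; first by rewrite zx; apply: new; rewrite -?zx.
  rewrite !b'E //; have [wx|wx] := eqVneq w x.
    by move: yz; rewrite (oneN y z) ?eqxx // mem_nbrs -wx ?wy ?wz.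
  by apply: (g3 w) => //; rewrite ?mem_nbrs ?wy ?wz !inS'.
Qed.

(** Only [b x1] and [b x4] face the many incidences around [u] and [v]. With two vertices between
    them, [x1] and [x4] have no common neighbour in [S], so these two colors are chosen
    independently. *)
Lemma colorable_thread S u x1 x2 x3 x4 v :
  uniq [:: u; x1; x2; x3; x4; v] -> all (mem S) [:: u; x1; x2; x3; x4; v] ->
  nbrs S x1 = [set u; x2] -> nbrs S x2 = [set x1; x3] ->
  nbrs S x3 = [set x2; x4] -> nbrs S x4 = [set x3; v] ->
  colorable (S :\: [set x1; x2; x3; x4]) -> colorable S.
Proof.
move=> U AS N1 N2 N3 N4 [a [b [g1 g2 g3]]].
set S' := S :\: _ in g1 g2 g3.
have memN x y : x \in S -> y \in nbrs S x -> x \in nbrs S y.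
  by move=> xS; rewrite !mem_nbrs xS adj_sym => /andP[->].
have [uS vS] : u \in S /\ v \in S by case/and5P: AS => ? _ _ _ /and3P[].
have x1S' : x1 \notin S' by rewrite !inE eqxx.
have x4S' : x4 \notin S' by rewrite !inE eqxx !orbT.
have u1 : adj u x1 by have : u \in nbrs S x1 by [rewrite N1 !inE eqxx]; rewrite mem_nbrs adj_sym => /andP[].
have v4 : adj v x4 by have : v \in nbrs S x4 by [rewrite N4 !inE eqxx orbT]; rewrite mem_nbrs adj_sym => /andP[].
(* Choosing the four values of [b] before those of [a] leaves a free color at
   each step, even when there are only six. *)
have [b1 [b1au b1bu b1N]] := @pendant_color S' a b u x1 x1S' u1.
have [b4 [b4av b4bv b4N]] := @pendant_color S' a b v x4 x4S' v4.
have avoid (s : seq 'I_K) : size s <= 5 -> exists c, c \notin s.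
  by move=> s5; apply: avoid_colors; apply: leq_ltn_trans K6.
have [//|b2] := avoid [:: b u; b1; b4]; rewrite !inE !negb_or => /and3P[b2u b21 b24].
have [//|b3] := avoid [:: b1; b2; b4; b v]; rewrite !inE !negb_or => /and4P[b31 b32 b34 b3v].
have [//|a1] := avoid [:: a u; b u; b1; b2]; rewrite !inE !negb_or => /and4P[a1au a1bu a1b1 a1b2].
have [//|a2] := avoid [:: a1; b1; b2; b3]; rewrite !inE !negb_or => /and4P[a2a1 a2b1 a2b2 a2b3].
have [//|a3] := avoid [:: a2; b2; b3; b4]; rewrite !inE !negb_or => /and4P[a3a2 a3b2 a3b3 a3b4].
have [//|a4] := avoid [:: a3; a v; b v; b4; b3]; rewrite !inE !negb_or => /and5P[a4a3 a4av a4bv a4b4 a4b3].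
pose upd (f : G -> 'I_K) c1 c2 c3 c4 z :=
  if z == x1 then c1 else if z == x2 then c2 else if z == x3 then c3 else
  if z == x4 then c4 else f z.
have updE f c1 c2 c3 c4 : [/\ upd f c1 c2 c3 c4 x1 = c1, upd f c1 c2 c3 c4 x2 = c2,
    upd f c1 c2 c3 c4 x3 = c3, upd f c1 c2 c3 c4 x4 = c4 &
    forall z, z \in S' -> upd f c1 c2 c3 c4 z = f z].
  move: U; rewrite /= !inE !negb_or -!andbA => /and5P[_ _ _ _ /and5P[_ n12 n13 n14 /and5P[_ n23 n24 _ /andP[n34 _]]]].
  rewrite /upd !eqxx !(eq_sym x2) !(eq_sym x3) !(eq_sym x4).
  rewrite (negbTE n12) (negbTE n13) (negbTE n14) (negbTE n23) (negbTE n24) (negbTE n34).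
  split => // z; rewrite !inE !negb_or -!andbA => /and5P[/negbTE-> /negbTE-> /negbTE-> /negbTE-> _] //.
pose a' := upd a a1 a2 a3 a4; pose b' := upd b b1 b2 b3 b4.
have [A1 A2 A3 A4 A0] := updE a a1 a2 a3 a4; have [B1 B2 B3 B4 B0] := updE b b1 b2 b3 b4.
rewrite -/a' in A1 A2 A3 A4 A0; rewrite -/b' in B1 B2 B3 B4 B0.
have uS' : u \in S'.
  move: U; rewrite inE uS andbT /= !inE !negb_or -!andbA => /and5P[-> -> -> -> _] //.
have vS' : v \in S'.
  move: U; rewrite inE vS andbT -[uniq _]rev_uniq /rev /= !inE !negb_or -!andbA.
  by move=> /and5P[-> -> -> -> _].
have split_S z : z \in S -> [\/ z \in S', z = x1, z = x2 | z = x3 \/ z = x4].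
  move=> zS; have [zS'|] := boolP (z \in S'); first by constructor 1.
  rewrite inE zS andbT negbK !inE -!orbA => /or4P[]/eqP->;
  by [constructor 2|constructor 3|constructor 4; left|constructor 4; right].
pose P z y := [&& a' z != a' y, b' z != b' y, a' z != b' y & a' y != b' z].
have PC z y : P z y -> P y z.
  by move=> /and4P[h1 h2 h3 h4]; apply/and4P; split; rewrite 1?eq_sym // eq_sym.
have [P1 P2 P3 P4] : [/\ {in nbrs S x1, forall y, P x1 y}, {in nbrs S x2, forall y, P x2 y},
    {in nbrs S x3, forall y, P x3 y} & {in nbrs S x4, forall y, P x4 y}].
  have Q1 : P x1 u by rewrite /P A1 B1 A0 // B0 // a1au b1bu a1bu eq_sym.
  have Q2 : P x2 x1 by rewrite /P A1 B1 A2 B2 a2a1 b21 a2b1 a1b2.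
  have Q3 : P x3 x2 by rewrite /P A3 B3 A2 B2 a3a2 b32 a3b2 a2b3.
  have Q4 : P x4 x3 by rewrite /P A4 B4 A3 B3 a4a3 (eq_sym b4) b34 a4b3 a3b4.
  have Q5 : P x4 v by rewrite /P A4 B4 A0 // B0 // a4av b4bv a4bv eq_sym.
  by split => y; rewrite ?N1 ?N2 ?N3 ?N4 !inE => /orP[]/eqP->; auto.
exists a', b'; split.
- move=> z /split_S[zS'|->|->|[->|->]]; rewrite ?A1 ?A2 ?A3 ?A4 ?B1 ?B2 ?B3 ?B4 //.
  by rewrite A0 // B0 //; exact: g1.
- move=> z y zS yS zy; have [yz zy'] : y \in nbrs S z /\ z \in nbrs S y.
    by rewrite !mem_nbrs yS zS zy adj_sym zy.
  suff : P z y by move=> /and4P[-> -> -> _].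
  case/split_S: (zS) => [zS'|zE|zE|[zE|zE]]; try (by rewrite zE in yz *; auto).
  case/split_S: (yS) => [yS'|yE|yE|[yE|yE]]; try (by apply: PC; rewrite yE in zy' *; auto).
  have /and3P[h1 h2 h3] := g2 z y zS' yS' zy.
  have /and3P[_ _ h4] := g2 y z yS' zS' (etrans (adj_sym y z) zy).
  by rewrite /P !A0 // !B0 // h1 h2 h3 h4.
- move=> w wS.
  have pair p q : b' p != b' q -> {in [set p; q] &, forall x y, x != y -> b' x != b' y}.
    by move=> pq x y; rewrite !inE => /orP[]/eqP-> /orP[]/eqP->; rewrite ?eqxx // (eq_sym (b' q)).
  case/split_S: (wS) => [wS'|->|->|[->|->]]; first last.
  + by rewrite N4; apply: pair; rewrite B3 B0.
  + by rewrite N3; apply: pair; rewrite B2 B4.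
  + by rewrite N2; apply: pair; rewrite B1 B3 eq_sym.
  + by rewrite N1; apply: pair; rewrite B2 B0 // eq_sym.
  (* A remaining vertex regains [x1] only if it is [u], and [x4] only if it is [v]; as [u != v],
     never both. *)
  have old z : z \in nbrs S w -> [\/ z \in nbrs S' w, z = x1 /\ w = u | z = x4 /\ w = v].
    move=> zw; have zS : z \in S by move: zw; rewrite mem_nbrs => /andP[].
    have wz := memN _ _ wS zw.
    have wn x : x \in [set x1; x2; x3; x4] -> w = x -> False.
      by move=> + wx; rewrite -wx => H; move: wS'; rewrite inE H.
    case/split_S: (zS) => [zS'|zE|zE|[zE|zE]].
    * by constructor 1; move: zw; rewrite !mem_nbrs zS' => /andP[->].
    * move: wz; rewrite zE N1 !inE => /orP[/eqP->|/eqP/wn]; first by constructor 2.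
      by case; rewrite !inE eqxx ?orbT.
    * by move: wz; rewrite zE N2 !inE => /orP[]/eqP/wn[]; rewrite !inE eqxx ?orbT.
    * by move: wz; rewrite zE N3 !inE => /orP[]/eqP/wn[]; rewrite !inE eqxx ?orbT.
    * move: wz; rewrite zE N4 !inE => /orP[/eqP/wn|/eqP->]; last by constructor 3.
      by case; rewrite !inE eqxx ?orbT.
  have uv : u != v by move: U; rewrite /= !inE !negb_or -!andbA => /and5P[_ _ _ _ /andP[]].
  have inS' z y : z \in nbrs S' y -> z \in S' by rewrite mem_nbrs => /andP[].
  move=> y z /old[yw|[yE wE]|[yE wE]] /old[zw|[zE wE']|[zE wE']] yz.
  + rewrite !B0 ?(inS' _ _ yw) ?(inS' _ _ zw) //; exact: (g3 w).
  + by rewrite zE B1 B0 ?(inS' _ _ yw) // eq_sym b1N // -wE'.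
  + by rewrite zE B4 B0 ?(inS' _ _ yw) // eq_sym b4N // -wE'.
  + by rewrite yE B1 B0 ?(inS' _ _ zw) // b1N // -wE.
  + by move: yz; rewrite yE zE eqxx.
  + by move: uv; rewrite -wE -wE' eqxx.
  + by rewrite yE B4 B0 ?(inS' _ _ zw) // b4N // -wE.
  + by move: uv; rewrite -wE -wE' eqxx.
  + by move: yz; rewrite yE zE eqxx.
Qed.

Lemma noncrossing_colorable (f : G -> nat) : injective f ->
  (forall u v w z, f u < f v -> f v < f w -> f w < f z -> adj u w -> adj v z -> False) ->
  girth_ge G 6 -> forall S, colorable S.
Proof.
move=> f_inj f_nc g6 S; have [n] := ubnP #|S|; elim: n S => // n IH S /ltnSE Sn.
have [S0|[x0 x0S]] := set_0Vmem S.
  have K0 : 0 < K by apply: leq_trans K6.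
  by exists (fun=> Ordinal K0), (fun=> Ordinal K0); split; move=> ?; rewrite S0 inE.
case: (boolP [exists x in S, #|nbrs S x| <= 1]) => [/existsP[x /andP[xS nx]]|].
  apply: (colorable_leaf xS nx); apply: IH.
  by apply: leq_trans Sn; rewrite [X in _ < X](cardsD1 x) xS.
rewrite negb_exists => /forallP nleaf.
have degS : {in S, forall x, 1 < #|nbrs S x|}.
  by move=> x xS; have := nleaf x; rewrite xS /= -ltnNge.
have [t [tinj tS tN]] := degree2_thread f_inj f_nc g6 x0S degS.
apply: (@colorable_thread S (t 0) (t 1) (t 2) (t 3) (t 4) (t 5)) => //.
- rewrite -[[:: _; _; _; _; _; _]]/(map t (iota 0 6)) map_inj_in_uniq ?iota_uniq //.
  by move=> k l; rewrite !mem_iota => k6 l6; exact: tinj.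
- by rewrite /= !tS.
- exact: (tN 1).
- exact: (tN 2).
- exact: (tN 3).
- exact: (tN 4).
apply: IH; apply: leq_trans Sn; apply: proper_card; apply/properP; split; first exact: subsetDl.
by exists (t 1); rewrite ?tS // !inE eqxx.
Qed.
End Coloring.

(** * Incidence colorings *)

Lemma dist_le3P (H : sgraph) (x y : H) : x != y -> dist_le 3 x y ->
  [\/ adj x y, exists2 z, adj x z & adj z y
    | exists z w, [/\ adj x z, adj z w & adj w y]].
Proof.
move=> xy [[|z [|w [|t [|? ?]]]] [/= p l s]] //.
- by rewrite l eqxx in xy.
- by move: p; rewrite l andbT; constructor 1.
- by move: p; rewrite l andbT => /andP[]; constructor 2; exists z.
- by move: p; rewrite l andbT => /and3P[]; constructor 3; exists z, w.
Qed.

Lemma dist_le_sym (H : sgraph) n (x y : H) : dist_le n x y -> dist_le n y x.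
Proof.
move=> [p [xp <- sp]]; exists (rev (belast x p)); split.
- by rewrite rev_path; apply: sub_path xp => a b; rewrite adj_sym.
- by case: p {xp sp} => //= z p; rewrite rev_cons last_rcons.
- by rewrite size_rev size_belast.
Qed.

Section Incidence.
Variable G : sgraph.
Notation adj := (@adj G).

Lemma incidence_ends (i : incidence G) :
  exists2 w, adj (inc_vertex i) w & inc_edge i = [set inc_vertex i; w].
Proof.
case: i => -[u e] /= ue; rewrite /inc_vertex /inc_edge /=.
move: (ue); rewrite inE => /andP[/existsP[x /existsP[y /andP[xy /eqP ->]]]].
rewrite !inE => /orP[]/eqP->; first by exists y.
by exists x; rewrite 1?adj_sym // finset.setUC.
Qed.

(** The default is never taken, because an edge has a second end. *)
Definition inc_other (i : incidence G) : G :=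
  odflt (inc_vertex i) [pick w | w \in inc_edge i :\ inc_vertex i].

Lemma inc_otherE (i : incidence G) w : adj (inc_vertex i) w ->
  inc_edge i = [set inc_vertex i; w] -> inc_other i = w.
Proof.
move=> iw ei; rewrite /inc_other; case: pickP => [z|/(_ w)] /=.
  by rewrite ei !inE => /andP[/negbTE -> /eqP].
by rewrite ei !inE eqxx orbT andbT eq_sym (adj_neq iw).
Qed.

Lemma inc_other_adj i : adj (inc_vertex i) (inc_other i).
Proof. by have [w iw ei] := incidence_ends i; rewrite (inc_otherE iw ei). Qed.

Lemma inc_edgeE i : inc_edge i = [set inc_vertex i; inc_other i].
Proof. by have [w iw ei] := incidence_ends i; rewrite (inc_otherE iw ei). Qed.

Lemma exists_inc u v : adj u v ->
  exists i : incidence G, inc_vertex i = u /\ inc_other i = v.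
Proof.
move=> uv; have H : ([set u; v] \in edges G) && (u \in [set u; v]).
  by rewrite adj_edge // !inE eqxx.
by exists (exist _ (u, [set u; v]) H); split => //; exact: inc_otherE.
Qed.

Lemma incidence_inj (i j : incidence G) : inc_vertex i = inc_vertex j ->
  inc_other i = inc_other j -> i = j.
Proof.
move=> ij oij; apply: val_inj; move: (inc_edgeE i) (inc_edgeE j); rewrite /inc_edge.
rewrite ij oij; move: ij; rewrite /inc_vertex; case: (val i) (val j) => [u e] [v f] /= -> -> ->.
by [].
Qed.

Lemma same_edge (i j : incidence G) : inc_edge i = inc_edge j ->
  inc_vertex i != inc_vertex j -> inc_vertex j = inc_other i /\ inc_other j = inc_vertex i.
Proof.
move=> eij nij.
have : inc_vertex j \in inc_edge i by rewrite eij inc_edgeE !inE eqxx.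
rewrite inc_edgeE !inE eq_sym (negbTE nij) => /eqP ji; split => //.
have : inc_vertex i \in inc_edge j by rewrite -eij inc_edgeE !inE eqxx.
by rewrite inc_edgeE !inE (negbTE nij) => /eqP.
Qed.

(** [i] lies in [I2 (inc_other i)], so all of [I2 v] receives the one color [b v]. *)
Definition color_of K (a b : G -> 'I_K) (z : G + incidence G) : 'I_K :=
  match z with inl v => a v | inr i => b (inc_other i) end.

(** Within distance 3 lie: adjacent vertices; a vertex and the incidences on its edges; two
    incidences on one edge, at one vertex, or one at a vertex [u] and one across an edge from [u].
    Incidences at one vertex use the third clause of [good]; the other pairs reduce to the first
    two. *)
Lemma good_vi_coloring K (a b : G -> 'I_K) :
  good [set: G] a b -> vi_coloring 1 (color_of a b).
Proof.
move=> [g1 g2 g3].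
have ga u v : adj u v -> a u != a v.
  by move=> uv; have /and3P[] := g2 u v (finset.in_setT _) (finset.in_setT _) uv.
have gb u v : adj u v -> b u != b v.
  by move=> uv; have /and3P[] := g2 u v (finset.in_setT _) (finset.in_setT _) uv.
have gab u v : adj u v -> a u != b v.
  by move=> uv; have /and3P[] := g2 u v (finset.in_setT _) (finset.in_setT _) uv.
have gs u : a u != b u by exact: g1.
have gn w u v : adj w u -> adj w v -> u != v -> b u != b v.
  by move=> wu wv; apply: (g3 w) => //; rewrite mem_nbrs ?wu ?wv inE.
have ao i : adj (inc_vertex i) (inc_other i) := inc_other_adj i.
have ao' i : adj (inc_other i) (inc_vertex i) by rewrite adj_sym.
split; last first.
  move=> v; apply: leq_trans (_ : #|[set b v]| <= 1); last by rewrite cards1.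
  apply/subset_leq_card/fintype.subsetP => c /imsetP[i]; rewrite !inE => /andP[vi /eqP ei] ->.
  by rewrite /= (inc_otherE _ ei) // adj_sym.
have gi (i j : incidence G) : i != j -> inc_vertex i = inc_vertex j ->
    b (inc_other i) != b (inc_other j).
  move=> ij vij; apply: (gn (inc_vertex i)) => //; first by rewrite vij.
  by apply: contra_neq ij; exact: incidence_inj.
have flip (i j : incidence G) : third_adj (inr i) (inr j) ->
    inc_vertex j = inc_other i /\ inc_other j = inc_vertex i.
  by move=> /andP[/eqP eij nij]; exact: same_edge.
have vi u i : dist_le 3 (inl u : third_power G) (inr i) -> a u != b (inc_other i).
  move=> /dist_le3P; case=> // [/eqP->|[[//|j] /eqP-> /flip[_ ->]]|] //=; first exact: gab.
  move=> [[z|j] [[w|k] []]] //= /eqP->.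
    by move=> /eqP<- /eqP->; exact: gab.
  by move=> /flip[_ kj] /flip[jk _]; rewrite -kj -jk; exact: gab.
have ii i j : i != j -> dist_le 3 (inr i : third_power G) (inr j) ->
    b (inc_other i) != b (inc_other j).
  move=> ij /dist_le3P; case=> [|/flip[_ ->]|[[w|k]]|[[w|k] [[w'|l] []]]] //.
  - exact: gb.
  - by move=> /= /eqP-> /eqP vij; apply: gi.
  - move=> /flip[ki ik] /flip[jk kj]; case/eqP: ij; apply: incidence_inj.
      by rewrite jk ik.
    by rewrite kj ki.
  - by move=> /= /eqP-> /eqP vl /flip[_ ->]; rewrite -vl; exact: gb.
  - by move=> /flip[ki _] /= /eqP-> /eqP kj; rewrite -ki kj; exact: gb.
  - by move=> /flip[ki ik] /flip[lk kl] /flip[_ ->]; rewrite lk ik; exact: gb.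
move=> x y xy dxy; case: x y xy dxy => [u|i] [v|j] xy dxy /=.
- case: (dist_le3P xy dxy) => [//|[[w|i] //= /eqP ui /eqP vi']|[[w|i] [[w'|j] []]] //= /eqP-> ij /eqP->].
    by move: xy; rewrite ui vi' eqxx.
  by have [-> _] := flip _ _ ij; exact: ga.
- exact: vi.
- by rewrite eq_sym; apply: vi; exact: dist_le_sym.
- by apply: ii => //; apply: contraNneq xy => ->.
Qed.

Lemma vi_colorable_degree K s (v : G) : vi_colorable G K s -> 0 < #|neighbours v| ->
  #|neighbours v| + 2 <= K.
Proof.
move=> [c [cp _]] /card_gt0P[u0]; rewrite inE => vu0.
have [i0 [vi0 oi0]] : exists i : incidence G, inc_vertex i = u0 /\ inc_other i = v.
  by apply: exists_inc; rewrite adj_sym.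
have /choice[g Hg] (u : G) : exists i : incidence G,
    adj v u -> inc_vertex i = v /\ inc_other i = u.
  case: (boolP (adj v u)) => [/exists_inc[i]|_]; [by exists i | by exists i0].
have vg u : adj v u -> third_adj (inl v) (inr (g u)).
  by move=> /Hg[/= -> _].
have gv u : adj v u -> third_adj (inr (g u)) (inl v).
  by move=> /Hg[/= -> _].
have gi0 : third_adj (inr (g u0)) (inr i0).
  have [vg0 og0] := Hg _ vu0.
  by rewrite /= !inc_edgeE vg0 og0 vi0 oi0 finset.setUC eqxx adj_neq.
have i0g u : adj v u -> g u != i0.
  move=> /Hg[vgu _]; apply: contraTneq vu0 => gi; move: vgu; rewrite gi vi0 => ->.
  by rewrite adj_irr.
have proper x y : x != y -> dist_le 3 (x : third_power G) y -> c x != c y by exact: cp.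
have cg u w : adj v u -> adj v w -> u != w -> c (inr (g u)) != c (inr (g w)).
  move=> vu vw uw; apply: proper; last first.
    exists [:: inl v; inr (g w)]; split => //.
    by apply/and3P; split => //; [exact: gv | exact: vg].
  apply: contra_neq uw => -[guw].
  by have [_ <-] := Hg _ vu; have [_ <-] := Hg _ vw; rewrite guw.
have cvg u : adj v u -> c (inl v) != c (inr (g u)).
  move=> vu; apply: proper => //; exists [:: inr (g u)]; split => //.
  by apply/andP; split => //; exact: vg.
have cv0 : c (inl v) != c (inr i0).
  apply: proper => //; exists [:: inr (g u0); inr i0]; split => //.
  by apply/and3P; split => //; exact: vg.
have cg0 u : adj v u -> c (inr (g u)) != c (inr i0).
  move=> vu; apply: proper.
    by apply: contraNneq (i0g _ vu) => -[->].
  (* For [u = u0] this walk backtracks, which [dist_le] permits. *)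
  exists [:: inl v; inr (g u0); inr i0]; split => //.
  by apply/and4P; split=> //; [exact: gv | exact: vg].
pose A := (fun u => c (inr (g u))) @: neighbours v.
have cA : #|A| = #|neighbours v|.
  apply: card_in_imset => u w; rewrite !inE => vu vw /eqP E.
  by apply/eqP/negPn/negP => uw; move: (cg _ _ vu vw uw); rewrite E.
have <- : #|c (inl v) |: (c (inr i0) |: A)| = #|neighbours v| + 2.
  rewrite !cardsU1 cA !inE (negbTE cv0) /=.
  have -> : c (inl v) \notin A.
    by apply/imsetP => -[u]; rewrite inE => /cvg/eqP.
  have -> : c (inr i0) \notin A.
    by apply/imsetP => -[u]; rewrite inE => /cg0 /eqP H /esym.
  by rewrite addnA addnC.
by rewrite -[X in _ <= X]card_ord max_card.
Qed.
End Incidence.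

Theorem theorem20 (R : realType) (G : sgraph) (Delta : nat) :
  k_connected G 2 ->
  outerplanar R G ->
  max_degree G = Delta ->
  4 <= Delta ->
  girth_ge G 6 ->
  chi_vi_eq G 1 (Delta + 2).
Proof.
move=> G2 outG degG D4 girG.
have deg_le (v : G) : #|neighbours v| + 2 <= Delta + 2.
  by rewrite leq_add2r -degG /max_degree (leq_bigmax v).
split.
  have D3 : 3 < max_degree G by rewrite degG.
  have [f f_inj f_nc] : exists2 f : G -> nat, injective f &
      forall a b c d, f a < f b -> f b < f c -> f c < f d ->
      adj a c -> adj b d -> False.
    apply: noncrossing_order => // u v s1 s2 s3; exact: (@outerplanar_no_theta R).
  (* The bound [4 <= Delta] supplies the six colors for extending along threads. *)
  have K6 : 6 <= Delta + 2 by rewrite (leq_add2r 2 4).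
  have [a [b ab]] := noncrossing_colorable K6 deg_le f_inj f_nc girG [set: G].
  by exists (color_of a b); exact: good_vi_coloring.
move=> K cK; have G0 : 0 < #|G| by case: G2 => G3 _; apply: leq_trans G3.
have [v vD] := bigop.eq_bigmax (fun v : G => #|neighbours v|) G0.
have vE : #|neighbours v| = Delta by rewrite -degG.
by rewrite -vE; apply: vi_colorable_degree cK _; rewrite vE (leq_trans _ D4).
Qed.
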